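(* The full subcategory $\mathsf{F}:=\{ \mathbf{1}, \mathbb{N}\langle\alpha\rangle\mid \alpha<\omega_1\}$ of $\mathsf{QCB_0}$ is cartesian closed and closed under countable $\mathsf{QCB_0}$-product. Moreover, $\mathsf{F}$ is the smallest such subcategory in the following sense: if $\mathsf{C}$ is a full cartesian closed subcategory of $\mathsf{QCB_0}$ which is closed under countable product inherited from $\mathsf{QCB_0}$ and contains the space $\omega$ as an object, then any $\mathsf{F}$-object is homeomorphic to a $\mathsf{C}$-object.
   Context: $\mathsf{QCB_0}$ is the cartesian closed category of qcb$_0$-spaces ($T_0$ quotients of countably based spaces) with continuous maps; $\mathbf{1}$ is a fixed one-point space. The spaces of continuous functionals of countable types are defined by $\mathbb{N}\langle 0\rangle:=\omega$ (discrete), $\mathbb{N}\langle\alpha+1\rangle:=\omega^{\mathbb{N}\langle\alpha\rangle}$ ($\mathsf{QCB_0}$-exponential), $\mathbb{N}\langle\lambda\rangle:=\prod_{\alpha<\lambda}\mathbb{N}\langle\alpha\rangle$ ($\mathsf{QCB_0}$-product) for countable limit ordinals $\lambda$. *)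

(* Defs.v *)
From mathcomp Require Import all_boot all_classical topology.
From mathcomp Require wochoice.

Set Implicit Arguments.
Unset Strict Implicit.
Unset Printing Implicit Defensive.

Local Open Scope classical_set_scope.

Definition quotient_map (A X : topologicalType) (q : A -> X) : Prop :=
  (forall x, exists a, q a = x) /\
  (forall U : set X, open U <-> open (q @^-1` U)).

Definition qcb0_space (X : topologicalType) : Prop :=
  kolmogorov_space X /\
  exists (A : topologicalType) (q : A -> X),
    @second_countable A /\ quotient_map q.

Record qcb0 := Qcb0 {
  qcb0_sort :> topologicalType;
  qcb0P : qcb0_space qcb0_sort }.

Definition homeomorphic (X Y : qcb0) : Prop :=
  exists (f : X -> Y) (g : Y -> X),
    [/\ continuous f, continuous g, cancel f g & cancel g f].

Lemma nat_qcb0 : qcb0_space nat.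
Proof.
split=> [x y xy|].
  exists [set x]; left; split; rewrite in_setE; first exact: discrete_set1.
  by move=> yx; move: xy; rewrite yx eqxx.
exists nat, id; split; last by split => // x; exists x.
exists (range (fun n : nat => [set n])).
  apply: (card_le_trans (card_image_le _ _)); exact: countableP.
split=> [A [n _ <-]|x A]; first exact: discrete_open.
by move=> Ax; exists [set x] => [|_ -> //=]; [split=> //; exists x|exact: nbhs_singleton].
Qed.

Lemma one_qcb0 : qcb0_space (discrete_topology unit).
Proof.
split; first by case=> -[].
exists (discrete_topology unit), id; split; last by split => // x; exists x.
exists [set setT]; first exact/finite_set_countable/finite_set1.
split=> [_ ->|[] A /nbhs_singleton At]; first exact: openT.
by exists setT => // -[].
Qed.

Definition omega : qcb0 := Qcb0 nat_qcb0.
Definition one : qcb0 := Qcb0 one_qcb0.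

(* A full subcategory of QCB_0 is given by its class of objects K; the        *)
(* following notions are the categorical ones, internal to that subcategory.  *)

Definition is_terminal (K : qcb0 -> Prop) (T : qcb0) : Prop :=
  K T /\ forall Z, K Z -> exists! h : Z -> T, continuous h.

Definition is_product (K : qcb0 -> Prop) (I : Type) (X : I -> qcb0)
    (P : qcb0) (pr : forall i, P -> X i) : Prop :=
  [/\ K P, forall i, continuous (pr i) &
    forall Z, K Z -> forall f : forall i, Z -> X i,
      (forall i, continuous (f i)) ->
      exists! h : Z -> P, continuous h /\ forall i, pr i \o h = f i].

Definition is_binary_product (K : qcb0 -> Prop) (X Y P : qcb0)
    (pr1 : P -> X) (pr2 : P -> Y) : Prop :=
  [/\ K P, continuous pr1, continuous pr2 &
    forall Z, K Z -> forall (f : Z -> X) (g : Z -> Y),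
      continuous f -> continuous g ->
      exists! h : Z -> P, [/\ continuous h, pr1 \o h = f & pr2 \o h = g]].

(* E is the exponential Y^X: every f : Z x X -> Y factors as                  *)
(* ev \o (g x id_X) for a unique g : Z -> E; the map h below is g x id_X.     *)
Definition is_exponential (K : qcb0 -> Prop) (X Y E : qcb0) : Prop :=
  K E /\
  exists (P : qcb0) (p1 : P -> E) (p2 : P -> X) (ev : P -> Y),
    [/\ is_binary_product K p1 p2, continuous ev &
      forall (Z Q : qcb0) (q1 : Q -> Z) (q2 : Q -> X), K Z ->
        is_binary_product K q1 q2 ->
        forall f : Q -> Y, continuous f ->
        exists! g : Z -> E, continuous g /\
          exists h : Q -> P,
            [/\ continuous h, p1 \o h = g \o q1, p2 \o h = q2
              & ev \o h = f]].

Definition cartesian_closed (K : qcb0 -> Prop) : Prop :=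
  [/\ exists T, is_terminal K T,
      forall X Y, K X -> K Y ->
        exists (P : qcb0) (pr1 : P -> X) (pr2 : P -> Y),
          is_binary_product K pr1 pr2
    & forall X Y, K X -> K Y -> exists E, is_exponential K X Y E].

Definition QCB0 : qcb0 -> Prop := fun=> True.

(* Countable includes finite and empty; the product is the one of QCB_0, and  *)
(* being a categorical notion it is determined only up to homeomorphism.      *)
Definition closed_countable_product (K : qcb0 -> Prop) : Prop :=
  forall (I : Type) (X : I -> qcb0), countable [set: I] ->
    (forall i, K (X i)) ->
    exists (P : qcb0) (pr : forall i, P -> X i), K P /\ is_product QCB0 pr.

(* QCB_0 is cartesian closed and has countable products, so on the arguments  *)
(* used below the default value is never taken.                               *)
Definition choose_space (S : qcb0 -> Prop) : qcb0 :=
  if pselect (exists X, S X) is left exS then proj1_sig (cid exS) else one.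

Definition exponential (Y X : qcb0) : qcb0 :=
  choose_space (is_exponential QCB0 X Y).

Definition product (I : Type) (X : I -> qcb0) : qcb0 :=
  choose_space (fun P => exists pr : forall i, P -> X i, is_product QCB0 pr).

(* The ordinal omega_1, as the elements of a well-ordering of the power set   *)
(* of nat that have only countably many predecessors. The lemmas below        *)
(* establish that its order type is omega_1.                                  *)

Definition powerset_le : rel (set nat) :=
  proj1_sig (wochoice.well_ordering_principle (set nat)).

Definition powerset_lt (x y : set nat) : Prop := x <> y /\ powerset_le x y.

Definition omega1 : Type :=
  {x : set nat | countable [set y | powerset_lt y x]}.

Definition omega1_lt (a b : omega1) : Prop :=
  powerset_lt (proj1_sig a) (proj1_sig b).

Lemma powerset_min (A : set (set nat)) : A !=set0 ->
  exists2 z, A z & forall x, A x -> powerset_le z x.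
Proof.
move=> [a Aa].
have [|z [[zA zmin] _]] :=
    proj2_sig (wochoice.well_ordering_principle (set nat)) (mem A).
  by exists a; apply/mem_set.
by exists z => [|x Ax]; [exact: set_mem|apply: zmin; exact/mem_set].
Qed.

Lemma powerset_le_anti x y : powerset_le x y -> powerset_le y x -> x = y.
Proof.
move=> xy yx; have [|z [_ zuniq]] :=
    proj2_sig (wochoice.well_ordering_principle (set nat)) (mem [set x; y]).
  by exists x; apply/mem_set; left.
have [w wxy wmin] := @powerset_min [set x; y] (ex_intro _ x (or_introl erefl)).
have rfl u : powerset_le u u.
  by have [v -> /(_ u erefl)] := @powerset_min [set u] (ex_intro _ u erefl).
rewrite -(zuniq x); last first.
  by split=> [|u /set_mem[]->//]; apply/mem_set; left.
by apply: zuniq; split=> [|u /set_mem[]->//]; apply/mem_set; right.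
Qed.

Lemma powerset_lt_trichotomy x y :
  [\/ powerset_lt x y, x = y | powerset_lt y x].
Proof.
have [->|xy] := pselect (x = y); first by constructor 2.
have [w [->|->] wmin] := @powerset_min [set x; y] (ex_intro _ x (or_introl erefl)).
- by constructor 1; split=> //; apply: wmin; right.
- by constructor 3; split; [exact/nesym|apply: wmin; left].
Qed.

Lemma powerset_lt_asym x y : powerset_lt x y -> ~ powerset_lt y x.
Proof. by move=> [xy lexy] [_ leyx]; apply/xy/powerset_le_anti. Qed.

Lemma omega1_lt_wf : well_founded omega1_lt.
Proof.
suff wf x : Acc powerset_lt x.
  move=> [x cx]; move: (wf x) cx; elim=> {}x _ IH cx.
  by constructor=> -[y cy] yx; exact: IH.
apply: contrapT => nx.
have [z nz zmin] := @powerset_min [set y | ~ Acc powerset_lt y] (ex_intro _ x nx).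
apply: nz; constructor=> y [yz leyz]; apply: contrapT => /zmin lezy.
exact/yz/powerset_le_anti.
Qed.

Lemma omega1_lt_trans a b c : omega1_lt a b -> omega1_lt b c -> omega1_lt a c.
Proof.
rewrite /omega1_lt; move: (proj1_sig a) (proj1_sig b) (proj1_sig c) => x y z xy yz.
have [//|xz|zx] := powerset_lt_trichotomy x z.
  by move: yz; rewrite -xz => /powerset_lt_asym.
have [w wS wmin] := @powerset_min [set x; y; z]
  (ex_intro _ x (or_introl (or_introl erefl))).
case: wS wmin => [[->|->]|->] wmin; exfalso.
- by case: zx => zx lezx; apply/zx/powerset_le_anti => //; apply: wmin; right.
- by case: xy => xy lexy; apply/xy/powerset_le_anti => //; apply: wmin; left; left.
- by case: yz => yz leyz; apply/yz/powerset_le_anti => //; apply: wmin; left; right.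
Qed.

Lemma omega1_inj : injective (fun a : omega1 => proj1_sig a).
Proof.
by move=> [x cx] [y cy] /= xy; move: cx cy; rewrite xy => cx cy;
  rewrite (Prop_irrelevance cx cy).
Qed.

Lemma omega1_lt_total a b : [\/ omega1_lt a b, a = b | omega1_lt b a].
Proof.
have [ab|ab|ba] := powerset_lt_trichotomy (proj1_sig a) (proj1_sig b).
- by constructor 1.
- by constructor 2; exact: omega1_inj.
- by constructor 3.
Qed.

Lemma omega1_segment_countable a : countable [set b | omega1_lt b a].
Proof.
case: a => x cx; have /countable_injP[f finj] := cx.
apply/countable_injP; exists (f \o @proj1_sig _ _).
move=> b c /set_mem bx /set_mem cx' /= /finj bc; apply/omega1_inj/bc; exact/mem_set.
Qed.

Lemma omega1_uncountable : ~ countable [set: omega1].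
Proof.
move=> /countable_injP[f finj].
pose S := [set x | countable [set y | powerset_lt y x]].
have cS : countable S.
  apply/countable_injP.
  exists (fun x => if pselect (S x) is left Sx then f (exist _ x Sx) else 0).
  move=> x y /set_mem Sx /set_mem Sy.
  case: pselect => [Sx'|/(_ Sx)//]; case: pselect => [Sy'|/(_ Sy)//] fxy.
  by have [] := finj _ _ (mem_set I) (mem_set I) fxy.
have [x nSx] : ~` S !=set0.
  apply/set0P; apply/negP => /eqP ST.
  have {}ST x : S x by apply: contrapT => nSx; have : set0 x by rewrite -ST.
  have /countable_injP[g ginj] := cS.
  pose D := [set n | exists2 x, g x = n & ~ x n].
  have [Dn|nDn] := pselect (D (g D)).
    by have [x /ginj xD] := Dn; rewrite xD ?mem_set.
  by apply: (nDn); exists D.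
have [z nSz zmin] := @powerset_min (~` S) (ex_intro _ x nSx).
apply: nSz; apply: sub_countable cS; apply: subset_card_le => y [yz leyz].
apply: contrapT => /zmin lezy; exact/yz/powerset_le_anti.
Qed.

Definition omega1_zero (a : omega1) : Prop := forall b, ~ omega1_lt b a.

Definition omega1_succ (a b : omega1) : Prop :=
  omega1_lt a b /\ forall c, omega1_lt c b -> ~ omega1_lt a c.

Definition functionals_step (a : omega1)
    (N : forall b, omega1_lt b a -> qcb0) : qcb0 :=
  if pselect (omega1_zero a) then omega else
  if pselect (exists b : {b | omega1_lt b a}, omega1_succ (proj1_sig b) a)
    is left ex_pred
  then let b := proj1_sig (cid ex_pred) in
       exponential omega (N (proj1_sig b) (proj2_sig b))
  else product (fun b : {b | omega1_lt b a} => N (proj1_sig b) (proj2_sig b)).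

Definition functionals : omega1 -> qcb0 :=
  Fix omega1_lt_wf (fun=> qcb0) functionals_step.

Lemma functionalsE a :
  functionals a = @functionals_step a (fun b _ => functionals b).
Proof.
apply: (Fix_eq omega1_lt_wf (fun=> qcb0) functionals_step) => {}a N N' NN'.
suff -> : N = N' by [].
apply: functional_extensionality_dep => b.
by apply: functional_extensionality_dep => ba; exact: NN'.
Qed.

Lemma functionals_zero a : omega1_zero a -> functionals a = omega.
Proof. by rewrite functionalsE /functionals_step; case: pselect. Qed.

Lemma functionals_succ a b : omega1_succ a b ->
  functionals b = exponential omega (functionals a).
Proof.
move=> ab; rewrite functionalsE /functionals_step.
case: (pselect (omega1_zero b)) => [b0|nb0]; first by case: (b0 a); case: ab.
case: pselect => [ex_pred|]; last first.
  by case; exists (exist _ a (proj1 ab)).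
case: cid => -[c cb] /= [_ cs]; congr (exponential _ (functionals _)).
have [ca|//|ac] := omega1_lt_total c a; exfalso.
  exact: cs (proj1 ab) ca.
exact: (proj2 ab) cb ac.
Qed.

Lemma functionals_limit a :
  ~ omega1_zero a -> ~ (exists b, omega1_succ b a) ->
  functionals a =
    product (fun b : {b | omega1_lt b a} => functionals (proj1_sig b)).
Proof.
move=> a0 alim; rewrite functionalsE /functionals_step.
case: (pselect (omega1_zero a)) => // na0.
by case: pselect => // -[[b ba] /= bs]; case: alim; exists b.
Qed.

Definition F : qcb0 -> Prop :=
  fun X => X = one \/ exists a : omega1, X = functionals a.

(* Main.v *)
(* A T0 quotient of a second countable space is sequential, so it is determined
   by its convergent sequences, and continuity is preservation of limits. All
   spaces are therefore handled as sets with a convergence relation, where the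
   product carries pointwise and the function space continuous convergence.
   Since a convergent sequence is a retract of Baire space B, universal
   properties in any full subcategory containing B pin down these convergence
   structures; this gives minimality and identifies the chosen exponentials and
   products once they are known to be qcb0, which is seen by naming points by
   subsets of nat.

   For the closure properties of F, call B a factor of A if A = B * C for some
   C. If B is a factor of A, then nat^B is a factor of nat^A (f is recovered
   from its restriction to B and its deviation from it). Hence N<a> is a factor
   of N<b> for a <= b, and N<b> is isomorphic to its countable power for b > 0.
   By Pelczynski's decomposition argument a countable product of spaces N<a_i>,
   not all a_i zero, is then isomorphic to N<sup a_i>, and exponentials follow
   by induction on the base using N<b+1>^X = nat^(X * N<b>). *)

From HB Require Import structures.
From mathcomp Require Import all_boot all_classical topology.
Require Import Defs.

Set Implicit Arguments.
Unset Strict Implicit.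
Unset Printing Implicit Defensive.

Local Open Scope classical_set_scope.

(** * Sets with convergent sequences *)

(** Only constant sequences are required to converge; the further properties of topological
    convergence enter later through [realizable]. *)
Record limspace := LimSpace {
  point :> Type;
  cv : (nat -> point) -> point -> Prop;
  cv_const : forall x, cv (fun=> x) x }.

Definition limcont (X Y : limspace) (f : X -> Y) : Prop :=
  forall u x, cv u x -> cv (f \o u) (f x).

Definition iso (X Y : limspace) : Prop :=
  exists (f : X -> Y) (g : Y -> X),
    [/\ cancel f g, cancel g f, limcont f & limcont g].

Lemma iso_refl X : iso X X.
Proof. by exists id, id; split. Qed.

Lemma iso_sym X Y : iso X Y -> iso Y X.
Proof. by move=> [f [g [fK gK cf cg]]]; exists g, f. Qed.

Lemma limcont_comp (X Y Z : limspace) (f : X -> Y) (g : Y -> Z) :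
  limcont f -> limcont g -> limcont (g \o f).
Proof. by move=> cf cg u x /cf /cg. Qed.

Lemma limcont_cst (X Y : limspace) (y : Y) : limcont (fun _ : X => y).
Proof. by move=> u x _; exact: cv_const. Qed.

Lemma iso_trans Y X Z : iso X Y -> iso Y Z -> iso X Z.
Proof.
move=> [f [g [fK gK cf cg]]] [f' [g' [fK' gK' cf' cg']]].
exists (f' \o f), (g \o g'); split; [exact: can_comp|exact: can_comp| |];
  exact: limcont_comp.
Qed.

Lemma iso_bij (X Y : limspace) (f : X -> Y) : injective f ->
  (forall y, exists x, f x = y) ->
  (forall u x, cv u x <-> cv (f \o u) (f x)) -> iso X Y.
Proof.
move=> finj /choice[g gK] fcv.
exists f, g; split=> //.
- by move=> x; apply: finj; rewrite gK.
- by move=> u x /fcv.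
- move=> u y uy; apply/fcv; rewrite gK; rewrite (_ : f \o _ = u) //.
  by apply: funext => n /=; rewrite gK.
Qed.

Lemma iso_point X Y : iso X Y -> inhabited X -> inhabited Y.
Proof. by move=> [f _] [x]; exists; exact: f. Qed.

Definition unit_lim : limspace :=
  @LimSpace unit (fun _ _ => True) (fun=> I).

Lemma nat_lim_const (x : nat) : \forall n \near \oo, x = x.
Proof. by exists 0. Qed.

Definition nat_lim : limspace :=
  @LimSpace nat (fun u x => \forall n \near \oo, u n = x) nat_lim_const.

Definition prod_lim (I : Type) (X : I -> limspace) : limspace :=
  @LimSpace (forall i, X i) (fun u x => forall i, cv (fun n => u n i) (x i))
    (fun x i => cv_const (x i)).

Definition pair_lim (X Y : limspace) : limspace :=
  @LimSpace (X * Y) (fun u x => cv (fst \o u) x.1 /\ cv (snd \o u) x.2)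
    (fun x => conj (cv_const x.1) (cv_const x.2)).

Lemma map_lim_const (X Y : limspace) (f : {f : X -> Y | limcont f})
  (v : nat -> X) x : cv v x -> cv (fun n => proj1_sig f (v n)) (proj1_sig f x).
Proof. exact: (proj2_sig f). Qed.

Definition map_lim (X Y : limspace) : limspace :=
  @LimSpace {f : X -> Y | limcont f} (fun u f => forall v x, cv v x ->
    cv (fun n => proj1_sig (u n) (v n)) (proj1_sig f x)) (@map_lim_const X Y).

Lemma map_lim_inj (X Y : limspace) (f g : map_lim X Y) :
  (forall x, proj1_sig f x = proj1_sig g x) -> f = g.
Proof.
by case: f g => [f cf] [g cg] /= fg; apply: eq_exist; exact: funext.
Qed.

(** * Canonical isomorphisms of products and function spaces *)

Lemma iso_prod I (X Y : I -> limspace) :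
  (forall i, iso (X i) (Y i)) -> iso (prod_lim X) (prod_lim Y).
Proof.
move=> XY.
have /(@all_sig _ _ (fun i f => exists g : Y i -> X i, _))[f] := fun i => cid (XY i).
move=> /(fun H i => cid (H i)) /(@all_sig _ _ (fun i g => _))[g fg].
exists (fun x i => f i (x i)), (fun y i => g i (y i)); split.
- by move=> x; apply: functional_extensionality_dep => i; case: (fg i) => fK *.
- by move=> x; apply: functional_extensionality_dep => i; case: (fg i) => ? gK *.
- by move=> u x ux i; case: (fg i) => _ _ cf _; apply: cf (ux i).
- by move=> u x ux i; case: (fg i) => _ _ _ cg; apply: cg (ux i).
Qed.

Lemma iso_pair X X' Y Y' :
  iso X X' -> iso Y Y' -> iso (pair_lim X Y) (pair_lim X' Y').
Proof.
move=> [f [g [fK gK cf cg]]] [f' [g' [fK' gK' cf' cg']]].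
exists (fun p => (f p.1, f' p.2)), (fun p => (g p.1, g' p.2)); split.
- by move=> [x y] /=; rewrite fK fK'.
- by move=> [x y] /=; rewrite gK gK'.
- by move=> u x [/cf ? /cf' ?].
- by move=> u x [/cg ? /cg' ?].
Qed.

Lemma iso_pairC X Y : iso (pair_lim X Y) (pair_lim Y X).
Proof.
by exists (fun p => (p.2, p.1)), (fun p => (p.2, p.1));
  split=> [[]|[]|u x []|u x []].
Qed.

Lemma iso_pairA X Y Z :
  iso (pair_lim X (pair_lim Y Z)) (pair_lim (pair_lim X Y) Z).
Proof.
exists (fun p => ((p.1, p.2.1), p.2.2)), (fun p => (p.1.1, (p.1.2, p.2))).
by split=> [[x []]|[[x y] z]|u x [? []]|u x [[] ? ?]].
Qed.

Lemma iso_pair_prod0 I (X : I -> limspace) Y : (I -> False) ->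
  iso (pair_lim Y (prod_lim X)) Y.
Proof.
move=> I0; exists fst, (fun y => (y, fun i => False_rect _ (I0 i))).
split=> [[y x]|//|u x []//|u y uy].
- by congr pair; apply: functional_extensionality_dep => i; case: (I0 i).
- by split=> // i; case: (I0 i).
Qed.

Lemma iso_prod0 I (X : I -> limspace) : (I -> False) ->
  iso (prod_lim X) unit_lim.
Proof.
move=> I0; exists (fun=> tt), (fun _ i => False_rect _ (I0 i)).
split=> [x|[]|u x _|u y _ i] //.
by apply: functional_extensionality_dep => i; case: (I0 i).
Qed.

Lemma iso_prod_pair I (X Y : I -> limspace) :
  iso (prod_lim (fun i => pair_lim (X i) (Y i)))
      (pair_lim (prod_lim X) (prod_lim Y)).
Proof.
exists (fun p => (fun i => (p i).1, fun i => (p i).2)), (fun p i => (p.1 i, p.2 i)).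
split=> [p|[x y]//|u x ux|u x [ux uy] i].
- by apply: functional_extensionality_dep => i /=; case: (p i).
- by split=> i; case: (ux i).
- by split; [exact: ux|exact: uy].
Qed.

Lemma iso_prod_reindex I J (f : I -> J) (g : J -> I) (X : J -> limspace) :
  cancel f g -> cancel g f -> iso (prod_lim X) (prod_lim (X \o f)).
Proof.
move=> fK gK; apply: (@iso_bij (prod_lim X) (prod_lim (X \o f)) (fun x i => x (f i))).
- move=> x y xy; apply: functional_extensionality_dep => j.
  by rewrite -(gK j); exact: (congr1 (@^~ (g j)) xy).
(* The value at [g j] is transported along [gK j]; at [j = f i] proof irrelevance removes the
   transport. *)
- move=> y; exists (fun j => eq_rect (f (g j)) X (y (g j)) j (gK j)).
  apply: functional_extensionality_dep => i; move: (gK (f i)).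
  by rewrite fK => e; rewrite (Prop_irrelevance e erefl).
- move=> u x; split=> [ux i|ux j]; first exact: ux.
  by rewrite -(gK j); exact: ux.
Qed.

(** The fibers of [t] partition [J]. An index outside the image of [t] contributes an empty product,
    that is, a point. *)
Lemma iso_prod_fibers I J (t : J -> I) (X : J -> limspace) :
  iso (prod_lim X)
      (prod_lim (fun i => prod_lim (fun j : {j | t j = i} => X (proj1_sig j)))).
Proof.
exists (fun x i j => x (proj1_sig j)), (fun y j => y (t j) (exist _ j erefl)).
split=> // [y|u x ux i [j ji]|u y uy j].
- apply: functional_extensionality_dep => i.
  by apply: functional_extensionality_dep => -[j ji]; case: _ / ji.
- exact: ux.
- exact: uy.
Qed.

Lemma iso_prod_curry I J (X : I -> J -> limspace) :
  iso (prod_lim (fun i => prod_lim (X i))) (prod_lim (fun p : I * J => X p.1 p.2)).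
Proof.
exists (fun x p => x p.1 p.2), (fun y i j => y (i, j)).
split=> // [y|u x ux p|u x ux i j].
- by apply: functional_extensionality_dep => -[].
- exact: ux.
- exact: (ux (i, j)).
Qed.

Lemma iso_prod_split I (X : I -> limspace) i :
  iso (prod_lim X)
      (pair_lim (X i) (prod_lim (fun j : {j | j <> i} => X (proj1_sig j)))).
Proof.
apply: (@iso_bij (prod_lim X) (pair_lim _ (prod_lim _))
          (fun x => (x i, fun j => x (proj1_sig j)))).
- move=> x y [xyi xy]; apply: functional_extensionality_dep => j.
  have [->//|ji] := pselect (j = i).
  exact: (congr1 (@^~ (exist _ j ji)) xy).
- move=> [a y]; exists (fun j => match pselect (i = j) with
    | left ij => eq_rect i X a j ij
    | right ij => y (exist _ j (not_eq_sym ij)) end).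
  congr pair; first by case: pselect => // e; rewrite (Prop_irrelevance e erefl).
  apply: functional_extensionality_dep => -[j ji] /=.
  case: pselect => [ij|ij]; first by case: (ji); rewrite ij.
  by rewrite (Prop_irrelevance (not_eq_sym ij) ji).
- move=> u x; split=> [ux|[uxi ux] j]; first by split=> [|[j ji]]; exact: ux.
  have [->//|ji] := pselect (j = i).
  exact: (ux (exist _ j ji)).
Qed.

Lemma iso_map X X' Y Y' :
  iso X X' -> iso Y Y' -> iso (map_lim X Y) (map_lim X' Y').
Proof.
move=> [f [g [fK gK cf cg]]] [f' [g' [fK' gK' cf' cg']]].
have cF (h : map_lim X Y) : limcont (f' \o proj1_sig h \o g).
  by apply: limcont_comp => //; apply: limcont_comp => //; exact: (proj2_sig h).
have cG (h : map_lim X' Y') : limcont (g' \o proj1_sig h \o f).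
  by apply: limcont_comp => //; apply: limcont_comp => //; exact: (proj2_sig h).
exists (fun h => exist _ _ (cF h)), (fun h => exist _ _ (cG h)); split.
- by move=> h; apply: map_lim_inj => x /=; rewrite fK' fK.
- by move=> h; apply: map_lim_inj => x /=; rewrite gK' gK.
- by move=> u h uh v x /cg /uh /cf'.
- by move=> u h uh v x /cf /uh /cg'.
Qed.

Lemma iso_map_curry X Y Z :
  iso (map_lim X (map_lim Y Z)) (map_lim (pair_lim X Y) Z).
Proof.
have cF (h : map_lim X (map_lim Y Z)) :
    @limcont (pair_lim X Y) Z (fun p => proj1_sig (proj1_sig h p.1) p.2).
  by move=> u x [/(proj2_sig h) ux1 /ux1 ux2].
have cG1 (h : map_lim (pair_lim X Y) Z) x : limcont (fun y => proj1_sig h (x, y)).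
  by move=> u y uy; apply: (proj2_sig h); split=> //; exact: cv_const.
have cG (h : map_lim (pair_lim X Y) Z) :
    @limcont X (map_lim Y Z) (fun x => exist _ _ (cG1 h x)).
  by move=> u x ux v y vy; apply: (proj2_sig h (fun n => (u n, v n)) (x, y)).
exists (fun h => exist _ _ (cF h)), (fun h => exist _ _ (cG h)); split.
- by move=> h; apply: map_lim_inj => x; apply: map_lim_inj.
- by move=> h; apply: map_lim_inj => -[].
- by move=> u h uh v x [vx1 vx2]; exact: (uh _ _ vx1 _ _ vx2).
- by move=> u h uh v x vx w y wy; apply: (uh (fun n => (v n, w n)) (x, y)).
Qed.

Lemma iso_map_prod X I (Y : I -> limspace) :
  iso (map_lim X (prod_lim Y)) (prod_lim (fun i => map_lim X (Y i))).
Proof.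
have cF (h : map_lim X (prod_lim Y)) i : limcont (fun x => proj1_sig h x i).
  by move=> u x /(proj2_sig h); exact.
have cG (h : prod_lim (fun i => map_lim X (Y i))) :
    @limcont X (prod_lim Y) (fun x i => proj1_sig (h i) x).
  by move=> u x ux i; apply: (proj2_sig (h i)).
exists (fun h i => exist _ _ (cF h i)), (fun h => exist _ _ (cG h)); split.
- by move=> h; apply: map_lim_inj.
- by move=> h; apply: functional_extensionality_dep => i; apply: map_lim_inj.
- by move=> u h uh i v x /uh; exact.
- by move=> u h uh v x vx i; exact: uh.
Qed.

(** A convergent sequence in [nat_lim] is eventually constant, so continuity and convergence of maps
    on [nat_lim * X] can be checked on each slice [{n} * X] separately. *)
Lemma iso_map_nat X :
  iso (map_lim (pair_lim nat_lim X) nat_lim)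
      (prod_lim (fun _ : nat => map_lim X nat_lim)).
Proof.
have cF (h : map_lim (pair_lim nat_lim X) nat_lim) (n : nat) :
    @limcont X nat_lim (fun x => proj1_sig h (n, x)).
  by move=> u x ux; apply: (proj2_sig h); split=> //; exists 0.
have cG (h : prod_lim (fun _ : nat => map_lim X nat_lim)) :
    @limcont (pair_lim nat_lim X) nat_lim (fun p => proj1_sig (h p.1) p.2).
  move=> u [k x] /= [uk /(proj2_sig (h k))]; apply: filterS2 uk => n /= ->.
  by [].
exists (fun h n => exist _ _ (cF h n)), (fun h => exist _ _ (cG h)); split.
- by move=> h; apply: map_lim_inj => -[].
- by move=> h; apply: functional_extensionality_dep => i; apply: map_lim_inj.
- by move=> u h uh i v x vx; apply: (uh (fun n => (i, v n)) (i, x)); split=> //; exists 0.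
- move=> u h uh v [k x] /= [vk /(uh k)]; apply: filterS2 vk => n /= ->.
  by [].
Qed.

Lemma iso_map_unit X : iso (map_lim X unit_lim) unit_lim.
Proof.
have c : @limcont X unit_lim (fun=> tt) by [].
exists (fun=> tt), (fun=> exist _ _ c); split=> // [h|[]//].
by apply: map_lim_inj => x /=; case: (proj1_sig h x).
Qed.

Lemma iso_unit_map X : iso (map_lim unit_lim X) X.
Proof.
have c x : @limcont unit_lim X (fun=> x) by move=> u y _; exact: cv_const.
exists (fun h => proj1_sig h tt), (fun x => exist _ _ (c x)); split=> //.
- by move=> h; apply: map_lim_inj => -[].
- by move=> u h uh; exact: uh (cv_const _).
- by move=> u x ux v [] _.
Qed.

(** * Factors and spaces isomorphic to their countable power *)

Definition factor (B A : limspace) : Prop := exists C, iso A (pair_lim B C).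

Definition stable (A : limspace) : Prop := iso (prod_lim (fun _ : nat => A)) A.

Lemma factor_refl A : factor A A.
Proof.
(* The complement is an empty product, hence a point. *)
exists (prod_lim (fun i : False => False_rect limspace i)).
by apply: iso_sym; exact: iso_pair_prod0.
Qed.

Lemma factor_trans B A C : factor A B -> factor B C -> factor A C.
Proof.
move=> [D BAD] [E CBE]; exists (pair_lim D E).
apply: (iso_trans CBE); apply: iso_trans (iso_sym (iso_pairA _ _ _)).
by apply: iso_pair => //; exact: iso_refl.
Qed.

Lemma iso_factor A B : iso B A -> factor A B.
Proof.
move=> AB; have [C AC] := factor_refl A.
by exists C; exact: iso_trans AC.
Qed.

Lemma factor_prod I (B A : I -> limspace) :
  (forall i, factor (B i) (A i)) -> factor (prod_lim B) (prod_lim A).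
Proof.
move=> /choice[C AC]; exists (prod_lim C).
by apply: iso_trans (iso_prod_pair _ _); exact: iso_prod.
Qed.

Lemma stable_iso A B : iso A B -> stable A -> stable B.
Proof.
move=> AB sA; apply: iso_trans (AB); apply: iso_trans sA.
by apply: iso_prod => _; apply: iso_sym.
Qed.

Lemma countable_bij_nat (T : Type) : countable [set: T] ->
  infinite_set [set: T] ->
  exists (f : T -> nat) (g : nat -> T), cancel f g /\ cancel g f.
Proof.
move=> cT iT; have /card_set_bijP[f [_ finj fsurj]] := eq_card_nat cT iT.
have /choice[g gK] : forall n, exists x, f x = n.
  by move=> n; have [x _ <-] := fsurj n I; exists x.
exists f, g; split=> // x; by apply: finj; rewrite ?inE ?gK.
Qed.

Lemma infinite_prod_nat (T : Type) (x : T) : infinite_set [set: T * nat].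
Proof.
move=> /(finite_image snd) fin; apply: infinite_nat.
rewrite (_ : [set: nat] = snd @` [set: T * nat]) //.
by apply/seteqP; split=> // n _; exists (x, n).
Qed.

(** Replacing [A] by [A^nat] turns the exponent [J] into [J * nat], which is countably infinite even
    when [J] is finite. *)
Lemma stable_power A J : stable A -> countable [set: J] -> inhabited J ->
  iso (prod_lim (fun _ : J => A)) A.
Proof.
move=> sA cJ [j].
have cJN : countable [set: J * nat].
  rewrite (_ : setT = setT `*` setT); last by apply/seteqP; split.
  by apply: countableX => //; exact: countableP.
have [f [g [fK gK]]] := countable_bij_nat cJN (infinite_prod_nat j).
apply: (iso_trans _ sA); apply: iso_trans (iso_sym (iso_prod_reindex _ fK gK)).
apply: iso_trans (iso_prod_curry (fun _ _ => A)).
by apply: iso_prod => _; exact: iso_sym.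
Qed.

Lemma iso_prod_nat_cons A :
  iso (prod_lim (fun _ : nat => A)) (pair_lim A (prod_lim (fun _ : nat => A))).
Proof.
exists (fun x => (x 0, x \o succn)), (fun p n => if n is m.+1 then p.2 m else p.1).
split=> [x|[x y]//|u x ux|u x [ux uy] [|n]//].
- by apply: funext => -[].
- by split=> [|n]; exact: ux.
- exact: uy.
Qed.

(* Pelczynski's decomposition: A = A^nat = B^nat * C^nat absorbs B. *)
Lemma stable_absorb A B : stable A -> factor B A -> iso (pair_lim A B) A.
Proof.
move=> sA [C ABC]; apply: (iso_trans (iso_pairC _ _)).
pose D := prod_lim (fun _ : nat => B).
pose E := prod_lim (fun _ : nat => C).
have ADE : iso A (pair_lim D E).
  apply: iso_trans (iso_prod_pair _ _); apply: (iso_trans (iso_sym sA)).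
  exact: iso_prod.
apply: (@iso_trans (pair_lim B (pair_lim D E))).
  exact: iso_pair (iso_refl _) ADE.
apply: (iso_trans (iso_pairA _ _ _)); apply: (iso_trans _ (iso_sym ADE)).
exact: iso_pair (iso_sym (iso_prod_nat_cons _)) (iso_refl _).
Qed.

(** For inhabited [J] the product of the [B j] is a factor of [A^J = A], so [stable_absorb] applies;
    for empty [J] it is a point. *)
Lemma factor_prod_stable J (B : J -> limspace) A : stable A ->
  countable [set: J] -> (forall j, factor (B j) A) -> iso (pair_lim A (prod_lim B)) A.
Proof.
move=> sA cJ BA; have [J0|nJ0] := pselect (J -> False); first exact: iso_pair_prod0.
have iJ : inhabited J by apply: contrapT => nJ; apply: nJ0 => j; case: nJ.
apply: stable_absorb => //; apply: factor_trans (factor_prod BA) _.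
by apply: iso_factor; apply: iso_sym; exact: stable_power.
Qed.

(** The map [t] assigns to each [B j] the coordinate that absorbs it: after grouping along the
    fibers of [t], every [X i] absorbs the factors of its own fiber. *)
Lemma prod_absorb I J (X : I -> limspace) (B : J -> limspace) (t : J -> I) :
  countable [set: J] -> (forall j, stable (X (t j))) ->
  (forall j, factor (B j) (X (t j))) ->
  iso (pair_lim (prod_lim X) (prod_lim B)) (prod_lim X).
Proof.
move=> cJ sX BX.
apply: iso_trans (iso_pair (iso_refl _) (iso_prod_fibers t B)) _.
apply: (iso_trans (iso_sym (iso_prod_pair _ _))); apply: iso_prod => i.
have [[j tj]|nj] := pselect (exists j, t j = i); last first.
  by apply: iso_pair_prod0 => -[j tj]; apply: nj; exists j.
apply: factor_prod_stable => [||[k tk]].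
- by rewrite -tj.
- have /countable_injP[f finj] := cJ; apply/countable_injP.
  exists (f \o @proj1_sig _ _) => -[a ta] [b tb] _ _ /= /finj ab.
  by apply: eq_exist; apply: ab; rewrite inE.
- by case: _ / tk.
Qed.

(** As a function of [b], the transposition of [0] and [a]. *)
Definition swap0 (a b : nat) := if b == a then 0 else if b == 0 then a else b.

Lemma swap0K a : involutive (swap0 a).
Proof.
move=> b; rewrite /swap0; case: (b =P a) => [->|/eqP ba].
  by case: (0 =P a).
by case: (b =P 0) => [->|/eqP b0]; rewrite ?eqxx // (negbTE ba) (negbTE b0).
Qed.

Lemma swap0_diag a : swap0 a a = 0.
Proof. by rewrite /swap0 eqxx. Qed.

(* Restriction along B * {c} splits: f is recovered from its restriction g and
   from swap0 (g b) (f (b, c')), which vanishes on B * {c}. *)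
Lemma factor_map B A : factor B A -> inhabited A ->
  factor (map_lim B nat_lim) (map_lim A nat_lim).
Proof.
move=> [C ABC] iA.
have [[_ c]] := iso_point ABC iA.
have cs (u : nat -> B) b : cv u b -> @cv (pair_lim B C) (fun n => (u n, c)) (b, c).
  by move=> ub; split=> //; exact: cv_const.
pose K := {f : map_lim (pair_lim B C) nat_lim | forall b, proj1_sig f (b, c) = 0}.
pose cvK (u : nat -> K) (x : K) := cv (fun n => proj1_sig (u n)) (proj1_sig x).
have cvK_const x : cvK (fun=> x) x by exact: cv_const.
exists (LimSpace cvK_const).
apply: (iso_trans (iso_map ABC (iso_refl _))).
have cF (f : map_lim (pair_lim B C) nat_lim) :
    @limcont B nat_lim (fun b => proj1_sig f (b, c)).
  by move=> u b ub; apply: (proj2_sig f); exact: cs.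
have cG (f : map_lim (pair_lim B C) nat_lim) : @limcont (pair_lim B C) nat_lim
    (fun p => swap0 (proj1_sig f (p.1, c)) (proj1_sig f p)).
  move=> u p up; have [up1 _] := up.
  have := proj2_sig f _ _ up; have := proj2_sig f _ _ (cs _ _ up1).
  by apply: filterS2 => n /= -> ->.
have F0 f b :
    proj1_sig (exist _ _ (cG f) : map_lim (pair_lim B C) nat_lim) (b, c) = 0 by exact: swap0_diag.
have cH (p : pair_lim (map_lim B nat_lim) (LimSpace cvK_const)) :
    @limcont (pair_lim B C) nat_lim
    (fun q => swap0 (proj1_sig p.1 q.1) (proj1_sig (proj1_sig p.2) q)).
  move=> u q uq; have [uq1 _] := uq.
  have := proj2_sig p.1 _ _ uq1; have := proj2_sig (proj1_sig p.2) _ _ uq.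
  by apply: filterS2 => n /= -> ->.
exists (fun f => (exist _ _ (cF f), exist _ _ (F0 f))), (fun p => exist _ _ (cH p)).
split.
- by move=> f; apply: map_lim_inj => p /=; rewrite swap0K.
- move=> [g [k k0]]; congr pair.
    apply: map_lim_inj => b /=; rewrite k0.
    by rewrite -[in RHS](swap0K (proj1_sig g b) (proj1_sig g b)) swap0_diag.
  apply: eq_exist; apply: map_lim_inj => -[b d] /=; rewrite k0.
  have -> : swap0 (proj1_sig g b) 0 = proj1_sig g b.
    by rewrite -[in RHS](swap0K (proj1_sig g b) (proj1_sig g b)) swap0_diag.
  by rewrite swap0K.
- move=> u f uf; split=> [v b vb|v p vp]; first exact: (uf _ _ (cs _ _ vb)).
  have [vp1 _] := vp; have := uf _ _ vp; have := uf _ _ (cs _ _ vp1).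
  by apply: filterS2 => n /= -> ->.
- move=> u [g k] [ug uk] v p vp; have [vp1 _] := vp.
  by have := uk _ _ vp; have := ug _ _ vp1; apply: filterS2 => n /= -> ->.
Qed.

(** * Spaces and their convergent sequences *)

Lemma cvg_openP (Z : topologicalType) (u : nat -> Z) x : u @ \oo --> x <->
  forall U, open U -> U x -> \forall n \near \oo, U (u n).
Proof.
split=> [ux U Uo Ux|ux A]; first exact/ux/open_nbhs_nbhs.
by rewrite nbhsE => -[U [Uo Ux] UA]; apply: filterS (ux U Uo Ux) => n /UA.
Qed.

Lemma cvg_seq_const (Z : topologicalType) (x : Z) : (fun=> x) @ \oo --> x.
Proof. exact: cvg_cst. Qed.

Definition seq_lim (Z : topologicalType) : limspace :=
  @LimSpace Z (fun u x => u @ \oo --> x) (@cvg_seq_const Z).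

Definition seq_open (V : limspace) (U : set V) : Prop :=
  forall u x, cv u x -> U x -> \forall n \near \oo, U (u n).

(** A countable base gives each point a decreasing sequence of neighbourhoods. If [U] is not a
    neighbourhood of [a], picking a point outside [U] from each of them yields a sequence that
    converges to [a] and avoids [U]. *)
Lemma second_countable_sequential (A : topologicalType) (U : set A) :
  @second_countable A -> @seq_open (seq_lim A) U -> open U.
Proof.
move=> [B /countable_injP[f finj] [Bo Bbase]] Useq.
rewrite openE => a Ua; rewrite /interior /=; apply: contrapT => nU.
(* [W k] is the base set with code [k] if that set exists and contains [a], and the whole space
   otherwise. *)
pose W k := [set y | forall D, B D -> f D = k -> D a -> D y].
have Wa k : nbhs a (W k).
  have [[D [BD fD Da]]|nD] := pselect (exists D, [/\ B D, f D = k & D a]).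
    apply: (@filterS _ _ _ D); last exact/open_nbhs_nbhs/(conj (Bo _ BD)).
    move=> y Dy E BE fE Ea; rewrite (_ : E = D) //.
    by apply: finj; rewrite ?inE // fE fD.
  by apply: nearW => y D BD fD Da; case: nD; exists D.
have Va n : nbhs a [set y | forall k, k <= n -> W k y].
  elim: n => [|n IH]; first by apply: filterS (Wa 0) => y Wy k; rewrite leqn0 => /eqP->.
  apply: filterS2 (Wa n.+1) IH => y Wy Vy k; rewrite leq_eqVlt => /predU1P[->//|].
  by rewrite ltnS => /Vy.
have /choice[u uP] : forall n, exists y, (forall k, k <= n -> W k y) /\ ~ U y.
  move=> n; apply: contrapT => nex; apply: nU; apply: filterS (Va n) => y Vy.
  by apply: contrapT => nUy; apply: nex; exists y.
have ua : u @ \oo --> a.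
  move=> N /Bbase[D [BD Da] DN]; exists (f D) => // n /= fDn.
  by apply: DN; apply: (proj1 (uP n) _ fDn).
have [n _ /(_ n (leqnn n))] := Useq u a ua Ua.
exact: (proj2 (uP n)).
Qed.

(** Sequential openness passes to the preimage under the quotient map, because the map preserves
    limits; there the second countable case applies. *)
Lemma qcb0_sequential (Z : qcb0) (U : set Z) : @seq_open (seq_lim Z) U -> open U.
Proof.
move=> Useq; have [_ [A [q [cA [_ qo]]]]] := qcb0P Z; apply/qo.
have qc : continuous q by apply/continuousP => O /qo.
apply: second_countable_sequential => // u a ua Ua.
by apply: (Useq (q \o u) (q a)) => //; exact: continuous_cvg (qc a) ua.
Qed.

Lemma continuous_limcont (Z : qcb0) (W : topologicalType) (f : Z -> W) :
  continuous f <-> @limcont (seq_lim Z) (seq_lim W) f.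
Proof.
split=> [cf u x ux|cf]; first exact: continuous_cvg (cf x) ux.
apply/continuousP => O Oo; apply: qcb0_sequential => u x /cf/cvg_openP; exact.
Qed.

Lemma homeomorphicP (X Y : qcb0) : homeomorphic X Y <-> iso (seq_lim X) (seq_lim Y).
Proof.
by split=> -[f [g []]]; exists f, g; split=> //; exact/continuous_limcont.
Qed.

Lemma near_all_in (s : seq nat) (P : nat -> nat -> Prop) :
  (forall k, k \in s -> \forall n \near \oo, P k n) ->
  \forall n \near \oo, forall k, k \in s -> P k n.
Proof.
elim: s => [|k s IH] Ps; first by exists 0.
apply: filterS2 (Ps k (mem_head _ _)) (IH _) => [n kn sn j|j js].
  by rewrite inE => /predU1P[->|/sn].
by apply: Ps; rewrite inE js orbT.
Qed.

(** * Limit spaces presented by names *)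

(** Convergence in the Scott topology on the power set of [nat], whose basic open sets are given by
    [names_below]. *)
Definition cv_names (s : nat -> set nat) (S : set nat) : Prop :=
  forall k, S k -> \forall n \near \oo, s n k.

Definition names (V : limspace) (nm : V -> set nat -> Prop) : Prop :=
  forall u x, cv u x <->
    exists s S, [/\ forall n, nm (u n) (s n), nm x S & cv_names s S].

Definition seq_closed (V : limspace) : Prop := forall (u : nat -> V) x,
  (forall U, seq_open U -> U x -> \forall n \near \oo, U (u n)) -> cv u x.

Definition separated (V : limspace) : Prop := forall x y : V, x <> y ->
  exists phi, @limcont V nat_lim phi /\ phi x <> phi y.

(** Sufficient conditions for the sequentially open sets to form a qcb0 topology whose convergence
    is exactly [cv]: names give the second countable space above it, [seq_closed] recovers [cv], and
    [separated] gives the T0 property. *)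
Definition realizable (V : limspace) : Prop :=
  [/\ exists nm, @names V nm, seq_closed V & separated V].

Definition names_below (l : seq nat) (S : set nat) : Prop := forall k, k \in l -> S k.

(* Otherwise there are indices n_0 < n_1 < ... and y_j with ~ P n_j y_j named by
   sets containing ever larger parts of S; the sequence that takes the value y_j
   at n_j and x elsewhere converges to x. *)
Lemma names_subseq (X : limspace) (nm : X -> set nat -> Prop) (P : nat -> X -> Prop) x S :
  names nm -> nm x S ->
  (forall u, cv u x -> \forall n \near \oo, P n (u n)) ->
  exists N, exists2 l : seq nat, names_below l S &
    forall n y T, N <= n -> nm y T -> names_below l T -> P n y.
Proof.
move=> nmX xS Px; apply: contrapT => nex.
pose l n := [seq k <- iota 0 n | `[< S k >]].
have lS n : names_below (l n) S by move=> k; rewrite mem_filter => /andP[/asboolP].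
have /choice[v vP] : forall j, exists p : nat * (X * set nat),
    [/\ j <= p.1, nm p.2.1 p.2.2, names_below (l j) p.2.2 & ~ P p.1 p.2.1].
  move=> j; apply: contrapT => np; apply: nex; exists j, (l j) => //.
  move=> n y T jn yT lT; apply: contrapT => nPy; apply: np; by exists (n, (y, T)).
(* The position in [v j] is at least [j], so consulting [v] just after the previous position makes
   [idx] strictly increasing. *)
pose idx := fix idx j := if j is j'.+1 then (v (idx j').+1).1 else (v 0).1.
pose w j := v (if j is j'.+1 then (idx j').+1 else 0).
have idxE j : idx j = (w j).1 by case: j.
have idx_lt j : idx j < idx j.+1 by rewrite /=; case: (vP (idx j).+1).
have idx_mono : {homo idx : i j / i < j}.
  by apply: homo_ltn => //; exact: ltn_trans.
have idx_ge j : j <= idx j.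
  by elim: j => // j IH; exact: leq_ltn_trans IH (idx_lt j).
have wl j : names_below (l j) (w j).2.2.
  have jle : j <= if j is j'.+1 then (idx j').+1 else 0 by case: j => //= j; rewrite ltnS.
  have [_ _ + _] := vP (if j is j'.+1 then (idx j').+1 else 0).
  rewrite -/(w j) => + k; rewrite mem_filter mem_iota => + /and3P[Sk _ kj].
  by apply; rewrite mem_filter mem_iota Sk (leq_trans kj).
pose z n := if pselect (exists j, idx j = n) is left e then (w (proj1_sig (cid e))).2
  else (x, S).
have zidx j : z (idx j) = (w j).2.
  rewrite /z; case: pselect => [e|[]]; last by exists j.
  case: cid => i /= ij; congr (w _).2.
  by case: (ltngtP i j) => // /idx_mono; rewrite ij ltnn.
have [N _ HN] : \forall n \near \oo, P n (z n).1.
  apply: Px; apply/nmX; exists (snd \o z), S; split=> // [n|k Sk].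
    rewrite /z /=; case: pselect => [e|_]//=.
    by rewrite /w; case: (vP (if proj1_sig (cid e) is j'.+1 then (idx j').+1 else 0)).
  (* An exceptional position from [idx k.+1] on is [idx j] with [k < j], and then [k] belongs to
     [l j]. *)
  exists (idx k.+1) => // n /= kn; rewrite /z; case: pselect => [e|_]//=.
  case: cid => j /= jn; apply: wl; rewrite mem_filter mem_iota; apply/and3P; split=> //.
    exact/asboolP.
  rewrite add0n ltnNge; apply/negP => jk.
  by have := idx_mono j k.+1 jk; rewrite jn ltnNge kn.
have := HN (idx N) (idx_ge N); rewrite zidx idxE.
by rewrite /w; case: (vP (if N is j'.+1 then (idx j').+1 else 0)).
Qed.

(** The case of a predicate independent of the index: sequential neighbourhoods of a point become
    neighbourhoods on the level of names. *)
Lemma names_nbhs (V : limspace) (nm : V -> set nat -> Prop) (P : set V) x S :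
  names nm -> nm x S -> (forall u, cv u x -> \forall n \near \oo, P (u n)) ->
  exists2 l : seq nat, names_below l S &
    forall y T, nm y T -> names_below l T -> P y.
Proof.
move=> nmV xS Px; have [N [l lS lP]] := names_subseq (P := fun=> P) nmV xS Px.
by exists l => // y T yT lT; exact: lP (leqnn N) yT lT.
Qed.

(** * The qcb0-space defined by a realizable limit space *)

Definition seq_topology (V : limspace) : Type := V.

HB.instance Definition _ (V : limspace) := gen_eqMixin (seq_topology V).
HB.instance Definition _ (V : limspace) := gen_choiceMixin (seq_topology V).

Lemma seq_openT (V : limspace) : seq_open [set: V].
Proof. by move=> u x _ _; exists 0. Qed.

Lemma seq_openI (V : limspace) (A B : set V) :
  seq_open A -> seq_open B -> seq_open (A `&` B).
Proof.
move=> oA oB u x ux [Ax Bx].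
by apply: filterS2 (oA u x ux Ax) (oB u x ux Bx) => n.
Qed.

Lemma seq_open_bigU (V : limspace) (I : Type) (f : I -> set V) :
  (forall i, seq_open (f i)) -> seq_open (\bigcup_i f i).
Proof.
move=> fo u x ux [i _ fx]; apply: filterS (fo i u x ux fx) => n fn.
by exists i.
Qed.

HB.instance Definition _ (V : limspace) := @isOpenTopological.Build
  (seq_topology V) (@seq_open V) (@seq_openT V) (@seq_openI V) (@seq_open_bigU V).

(** One set may name several points, so elements are pairs of a point and a name. The topology sees
    only the name, which keeps it second countable. *)
Definition name_space (V : limspace) (nm : V -> set nat -> Prop) : Type :=
  {p : V * set nat | nm p.1 p.2}.

HB.instance Definition _ (V : limspace) (nm : V -> set nat -> Prop) :=
  gen_eqMixin (name_space nm).
HB.instance Definition _ (V : limspace) (nm : V -> set nat -> Prop) :=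
  gen_choiceMixin (name_space nm).

Definition name_ball (V : limspace) (nm : V -> set nat -> Prop)
    (l : seq nat) : set (name_space nm) :=
  [set p | forall k, k \in l -> (proj1_sig p).2 k].

Definition name_open (V : limspace) (nm : V -> set nat -> Prop)
    (O : set (name_space nm)) : Prop :=
  forall p, O p -> exists2 l, name_ball l p & name_ball l `<=` O.

Lemma name_openT (V : limspace) (nm : V -> set nat -> Prop) :
  name_open [set: name_space nm].
Proof. by move=> p _; exists [::]. Qed.

Lemma name_openI (V : limspace) (nm : V -> set nat -> Prop) :
  setI_closed (@name_open V nm).
Proof.
move=> A B oA oB p [/oA[l lp lA] /oB[m mp mB]]; exists (l ++ m).
  by move=> k; rewrite mem_cat => /orP[/lp|/mp].
by move=> q lmq; split; [apply: lA|apply: mB] => k kl; apply: lmq;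
  rewrite mem_cat kl ?orbT.
Qed.

Lemma name_open_bigU (V : limspace) (nm : V -> set nat -> Prop)
    (I : Type) (f : I -> set (name_space nm)) :
  (forall i, name_open (f i)) -> name_open (\bigcup_i f i).
Proof.
move=> fo p [i _ /fo[l lp lf]]; exists l => // q /lf fq; by exists i.
Qed.

HB.instance Definition _ (V : limspace) (nm : V -> set nat -> Prop) :=
  @isOpenTopological.Build (name_space nm) (@name_open V nm)
    (@name_openT V nm) (@name_openI V nm) (@name_open_bigU V nm).

Lemma name_ball_open (V : limspace) (nm : V -> set nat -> Prop) l :
  open (@name_ball V nm l).
Proof. by move=> p lp; exists l. Qed.

Lemma name_space_second_countable (V : limspace) (nm : V -> set nat -> Prop) :
  @second_countable (name_space nm).
Proof.
exists (range (@name_ball V nm)).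
  apply: (card_le_trans (card_image_le _ _)); exact: countableP.
split=> [_ [l _ <-]|p A]; first exact: name_ball_open.
rewrite nbhsE => -[O [oO Op] OA]; have [l lp lO] := oO p Op.
exists (name_ball l) => [|q /lO/OA//]; by split=> //; exists l.
Qed.

(** Sequentially open sets have open preimages by [names_nbhs]. Conversely, a convergent sequence
    lifts to convergent names, which eventually enter every ball around the name of the limit. *)
Lemma seq_topology_quotient (V : limspace) (nm : V -> set nat -> Prop) :
  names nm ->
  @quotient_map (name_space nm) (seq_topology V) (fun p => (proj1_sig p).1).
Proof.
move=> nmV; split=> [x|U]; first have /nmV[s [S [_ xS _]]] := cv_const x.
  by exists (exist (fun p : V * set nat => nm p.1 p.2) (x, S) xS).
split=> [Uo|qo].
  change (name_open ((fun p : name_space nm => (proj1_sig p).1) @^-1` U)).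
  move=> [[x S] xS] Ux.
  have [|l lS lU] := names_nbhs (P := U) nmV xS; first by move=> u /Uo; exact.
  by exists l => // -[[y S'] yS'] /= lS'; exact: lU yS' lS'.
change (@seq_open V U); move=> u x /nmV[s [S [us xS sS]]] Ux.
have [l lS lU] := qo (exist (fun p : V * set nat => nm p.1 p.2) (x, S) xS) Ux.
have : \forall n \near \oo, forall k, k \in l -> s n k.
  by apply: near_all_in => k /lS; exact: sS.
apply: filterS => n sl.
exact: (lU (exist (fun p : V * set nat => nm p.1 p.2) (u n, s n) (us n)) sl).
Qed.

Lemma realizable_qcb0 V : realizable V -> exists E : qcb0, iso (seq_lim E) V.
Proof.
move=> [[nm nmV] clV sepV].
have QV : qcb0_space (seq_topology V).
  split; last first.
    exists (name_space nm), (fun p => (proj1_sig p).1); split.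
      exact: name_space_second_countable.
    exact: seq_topology_quotient.
  move=> x y /eqP xy; have [phi [cphi phixy]] := sepV x y xy.
  exists [set z | phi z = phi x]; left; split; rewrite inE; last exact/nesym.
  have oU : @seq_open V [set z | phi z = phi x].
    by move=> u z uz /= <-; exact: cphi uz.
  by apply: open_nbhs_nbhs; split.
exists (Qcb0 QV), id, id; split=> // u x => [/cvg_openP ux|ux].
  by apply: clV => U; exact: ux.
by apply/cvg_openP => U oU; exact: oU ux.
Qed.

Lemma realizable_iso V W : iso V W -> realizable V -> realizable W.
Proof.
move=> [f [g [fK gK cf cg]]] [[nm nmV] clV sepV]; split.
- exists (fun w => nm (g w)) => u x; split=> [/cg/nmV//|uS].
  have /cf : cv (g \o u) (g x) by apply/nmV.
  by rewrite gK (_ : f \o _ = u) //; apply: funext => n /=; rewrite gK.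
- move=> u x ux; have /cf : cv (g \o u) (g x).
    apply: clV => U oU Ux; apply: (ux (g @^-1` U)) => // v y /cg; exact: oU.
  by rewrite gK (_ : f \o _ = u) //; apply: funext => n /=; rewrite gK.
- move=> x y xy; have [/(can_inj gK)//|phi [cphi phixy]] := sepV (g x) (g y).
  by exists (phi \o g); split=> //; exact: limcont_comp cphi.
Qed.

(** * Realizability of the naturals, countable products and function spaces *)

Lemma realizable_nat : realizable nat_lim.
Proof.
split.
- exists (fun n S => S = [set n]) => u x; split=> [ux|[s [S [us -> sS]]]].
    exists (fun n => [set u n]), [set x]; split=> // k ->.
    by apply: filterS ux => n /= ->.
  by apply: filterS (sS x erefl) => n; rewrite us => ->.
- move=> u x ux; apply: (ux [set x]) => // v y vy yx.
  by apply: filterS vy => n ->.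
- by move=> x y xy; exists id; split.
Qed.

(** A name of a point is the disjoint union of names of its coordinates, with [k] in the name of
    coordinate [i] coded as [pickle (c i, k)]. The other two conditions are inherited through the
    projections. *)
Lemma realizable_prod (I : Type) (X : I -> limspace) : countable [set: I] ->
  (forall i, realizable (X i)) -> realizable (prod_lim X).
Proof.
move=> /countable_injP[c cinj] rX.
have {}cinj : injective c by move=> i j; apply: cinj; rewrite inE.
split.
- have [nm nmX] : exists nm : forall i, X i -> set nat -> Prop,
      forall i, names (nm i).
    have H i : exists nm, @names (X i) nm by case: (rX i).
    by exists (fun i => proj1_sig (cid (H i))) => i; exact: (proj2_sig (cid (H i))).
  exists (fun x S => forall i, nm i (x i) [set k | S (pickle (c i, k))]) => u x; split.
    move=> ux; have {}ux i : exists sS : (nat -> set nat) * set nat,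
        [/\ forall n, nm i (u n i) (sS.1 n), nm i (x i) sS.2 & cv_names sS.1 sS.2].
      by have /nmX[s [S sS]] := ux i; exists (s, S).
    have {ux}[sS sSP] := choice ux.
    pose code (T : I -> set nat) : set nat :=
      [set m | exists i k, m = pickle (c i, k) /\ T i k].
    have codeE T i : [set k | code T (pickle (c i, k))] = T i.
      apply/seteqP; split=> k /=; last by move=> Tik; exists i, k.
      by move=> [j [l [/(pcan_inj pickleK)[/cinj-> ->]]]].
    exists (fun n => code (fun i => (sS i).1 n)), (code (fun i => (sS i).2)); split.
    + by move=> n i; rewrite codeE; case: (sSP i).
    + by move=> i; rewrite codeE; case: (sSP i).
    + move=> _ [i [k [-> Sk]]]; have [_ _ /(_ k Sk)] := sSP i.
      by apply: filterS => n sk; exists i, k.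
  move=> [s [S [us xS sS]]] i; apply/nmX.
  exists (fun n => [set k | s n (pickle (c i, k))]), [set k | S (pickle (c i, k))].
  by split=> // k /sS.
- move=> u x ux i; have [_ clX _] := rX i; apply: clX => U oU Ux.
  by apply: (ux [set y | U (y i)]) => // v y /(_ i); exact: oU.
- move=> x y xy; have [i xyi] : exists i, x i <> y i.
    apply: contrapT => nxy; apply: xy; apply: functional_extensionality_dep => i.
    by apply: contrapT => xyi; apply: nxy; exists i.
  have [_ _ /(_ _ _ xyi)[phi [cphi phixy]]] := rX i.
  by exists (fun z => phi (z i)); split=> // u z /(_ i); exact: cphi.
Qed.

Lemma iso_prod_bool (X : bool -> limspace) :
  iso (prod_lim X) (pair_lim (X true) (X false)).
Proof.
exists (fun x => (x true, x false)), (fun p b => if b is true then p.1 else p.2).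
split=> [x|[x y]//|u x ux|u x [ux uy] []//].
- by apply: functional_extensionality_dep => -[].
- by split; exact: ux.
Qed.

Lemma realizable_pair X Y : realizable X -> realizable Y -> realizable (pair_lim X Y).
Proof.
move=> rX rY; apply: realizable_iso (iso_prod_bool (fun b => if b then X else Y)) _.
by apply: realizable_prod => [|[]]//; exact: countableP.
Qed.

Definition constant_on (X : limspace) (nm : X -> set nat -> Prop) (f : X -> nat)
    (l : seq nat) (c : nat) : Prop :=
  forall x S, nm x S -> names_below l S -> f x = c.

(* The number coding (l, c) in a name of f asserts that f takes the value c at
   all points having a name above the finite set l. *)
Definition map_names (X : limspace) (nm : X -> set nat -> Prop)
    (f : map_lim X nat_lim) (S : set nat) : Prop :=
  (forall l c, S (pickle (l, c)) -> constant_on nm (proj1_sig f) l c) /\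
  (forall x T, nm x T -> exists2 l : seq nat,
    names_below l T & S (pickle (l, proj1_sig f x))).

Lemma cv_names_below s S l : cv_names s S -> names_below l S ->
  \forall n \near \oo, names_below l (s n).
Proof.
by move=> sS lS; apply: near_all_in => k /lS; exact: sS.
Qed.

(** Some assertion [(l, g x)] in the name of [g] has [l] below the name of [x]. It eventually lies
    in the names of the [f k], and [l] is eventually below the names of the [u n]; hence [k] and [n]
    may vary independently, which [realizable_map] relies on. *)
Lemma map_names_cv (X : limspace) (nm : X -> set nat -> Prop)
  (f : nat -> map_lim X nat_lim)
  (g : map_lim X nat_lim) s S : names nm ->
  (forall n, map_names nm (f n) (s n)) -> map_names nm g S -> cv_names s S ->
  forall u x, cv u x -> exists N, forall k n, N <= k -> N <= n ->
    proj1_sig (f k) (u n) = proj1_sig g x.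
Proof.
move=> nmX fs gS sS u x /nmX[t [T [ut xT tT]]].
have [l lT Sl] := proj2 gS x T xT.
have [N1 _ H1] := cv_names_below tT lT; have [N2 _ H2] := sS _ Sl.
exists (maxn N1 N2) => k n; rewrite !geq_max => /andP[_ kN] /andP[nN _].
exact: (proj1 (fs k) _ _ (H2 k kN) _ _ (ut n) (H1 n nN)).
Qed.

Lemma map_lim_names (X : limspace) (nm : X -> set nat -> Prop) :
  names nm -> @names (map_lim X nat_lim) (map_names nm).
Proof.
move=> nmX f g; split; last first.
  move=> [s [S [fs gS sS]]] u x ux.
  have [N HN] := map_names_cv nmX fs gS sS ux.
  by exists N => // n nN; exact: HN.
move=> fg.
pose C (h : map_lim X nat_lim) : set nat := [set m |
  exists l c, m = pickle (l, c) /\ constant_on nm (proj1_sig h) l c].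
(* Keeping only the assertions eventually shared by the [f n] makes the names converge trivially;
   that enough of them remain to name [g] follows from [names_subseq]. *)
pose S : set nat := [set m | C g m /\ \forall n \near \oo, C (f n) m].
have CP h l c : C h (pickle (l, c)) <-> constant_on nm (proj1_sig h) l c.
  by split=> [[l' [c' [/(pcan_inj pickleK)[-> ->]]]]//|hlc]; exists l, c.
have Cname h : forall x T, nm x T -> exists2 l : seq nat,
    names_below l T & C h (pickle (l, proj1_sig h x)).
  move=> x T xT; have [|l lT hl] :=
    names_nbhs (P := [set y | proj1_sig h y = proj1_sig h x]) nmX xT.
    by move=> u /(proj2_sig h).
  by exists l => //; apply/CP => y T' yT'; exact: hl.
exists (fun n => C (f n)), S; split.
- by move=> n; split=> [l c /CP//|]; exact: Cname.
- split=> [l c [/CP]//|x T xT].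
  have [l1 l1T gl1] := Cname g x T xT.
  have [N [l2 l2T fl2]] := names_subseq
    (P := fun n y => proj1_sig (f n) y = proj1_sig g x) nmX xT
    (fun u ux => fg u x ux).
  (* [l1] secures the assertion for [g], and [l2] secures it for almost all [f n]. *)
  exists (l1 ++ l2); first by move=> k; rewrite mem_cat => /orP[/l1T|/l2T].
  split; first apply/CP => y T' yT' lT'.
    by move/CP: gl1; apply; eauto => k kl; apply: lT'; rewrite mem_cat kl.
  exists N => // n nN; apply/CP => y T' yT' lT'.
  by apply: fl2 yT' _ => // k kl; apply: lT'; rewrite mem_cat kl orbT.
- by move=> m [].
Qed.

Lemma realizable_map X : realizable X -> realizable (map_lim X nat_lim).
Proof.
move=> [[nm nmX] _ _]; split.
- by exists (map_names nm); exact: map_lim_names.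
- move=> f g fg u x ux /=; set c := proj1_sig g x.
  have [m _ gm] : \forall n \near \oo, proj1_sig g (u n) = c by exact: (proj2_sig g).
  (* A single test set suffices: [O] contains [g], and [f n] in [O] has value [c] at [u n] once
     [m <= n]. *)
  pose O : set (map_lim X nat_lim) := [set h | forall n, m <= n -> proj1_sig h (u n) = c].
  suff oO : seq_open O.
    have [N _ HN] := fg O oO gm; exists (maxn N m) => // n /=.
    by rewrite geq_max => /andP[nN nm']; exact: HN.
  move=> h k /(map_lim_names nmX)[s [S [hs kS sS]]] Ok.
  have [N HN] := map_names_cv nmX hs kS sS ux.
  have kx : proj1_sig k x = c.
    have [M _ HM] : \forall n \near \oo, proj1_sig k (u n) = proj1_sig k x.
      exact: (proj2_sig k).
    by rewrite -(HM (maxn M m)) ?Ok /= ?leq_maxl ?leq_maxr.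
  (* From [N] on the joint estimate applies; the finitely many earlier terms are treated one by one,
     each along a constant sequence. *)
  have : \forall j \near \oo, forall n, n < N -> proj1_sig (h j) (u n) = proj1_sig k (u n).
    elim: (N) => [|M IH]; first by exists 0.
    have hM : \forall j \near \oo, proj1_sig (h j) (u M) = proj1_sig k (u M).
      have /(map_lim_names nmX) hk : exists s S, [/\ forall n, map_names nm (h n) (s n),
        map_names nm k S & cv_names s S] by exists s, S.
      exact: (hk _ _ (cv_const (u M))).
    apply: filterS2 hM IH => j hM IH n; rewrite ltnS leq_eqVlt.
    by move=> /predU1P[->|/IH].
  have hN : \forall j \near \oo, N <= j by exists N.
  apply: filterS2 hN => j jN hj n mn; have [nN|Nn] := ltnP n N.
    by rewrite hj // Ok.
  by rewrite HN.
- move=> f g fg; have [x fgx] : exists x, proj1_sig f x <> proj1_sig g x.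
    apply: contrapT => nfg; apply: fg; apply: map_lim_inj => x.
    by apply: contrapT => fgx; apply: nfg; exists x.
  exists (fun h => proj1_sig h x); split=> // u h uh; exact: uh (cv_const x).
Qed.

(** * Universal properties tested on Baire space *)

Definition baire : limspace := prod_lim (fun _ : nat => nat_lim).

Definition spike (n : nat) : baire := fun k => k == n.

Definition flat : baire := fun=> 0.

Lemma cv_spike : cv spike flat.
Proof.
move=> k; exists k.+1 => // n /= kn.
by rewrite /spike /flat (ltn_eqF kn).
Qed.

Lemma cv_baire_prefix (v : nat -> baire) b N : cv v b ->
  \forall n \near \oo, forall k, k < N -> v n k = b k.
Proof.
move=> vb; elim: N => [|N IH]; first by exists 0.
apply: filterS2 (vb N) IH => n vN IH k; rewrite ltnS leq_eqVlt.
by move=> /predU1P[->|/IH].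
Qed.

(** A retraction of Baire space onto the spikes and their limit, sending [b] to the spike at its
    first nonzero index, followed by the sequence [u] with limit [x]. *)
Definition probe (Z : Type) (u : nat -> Z) (x : Z) (b : baire) : Z :=
  if pselect (exists k, b k != 0) is left e then u (ex_minn e) else x.

Lemma probe_spike Z (u : nat -> Z) x n : probe u x (spike n) = u n.
Proof.
rewrite /probe; case: pselect => [e|[]]; last by exists n; rewrite /spike eqxx.
by case: ex_minnP => m + _; rewrite /spike; case: (m =P n) => [->|].
Qed.

Lemma probe_flat Z (u : nat -> Z) x : probe u x flat = x.
Proof. by rewrite /probe; case: pselect => // -[]. Qed.

(* A closed subset of Baire space is a retract of it; here, the convergent
   sequence of the spikes. *)
Lemma limcont_probe (Z : topologicalType) (u : nat -> Z) x :
  u @ \oo --> x -> @limcont baire (seq_lim Z) (probe u x).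
Proof.
move=> /cvg_openP ux v b vb; apply/cvg_openP => U oU.
rewrite {1}/probe; case: pselect => [e|nb] Ub.
  case: ex_minnP Ub => k bk kmin Uk.
  apply: filterS (cv_baire_prefix k.+1 vb) => n vbn.
  rewrite /= /probe; case: pselect => [e'|[]]; last by exists k; rewrite vbn.
  case: ex_minnP => m vm mmin; suff -> : m = k by [].
  have mk : m <= k by apply: mmin; rewrite vbn.
  by apply/eqP; rewrite eqn_leq mk kmin // -vbn.
(* Here [b] vanishes everywhere, so agreement with [b] below [N] pushes the first nonzero index to
   [N] or beyond. *)
have [N _ HN] := ux U oU Ub.
apply: filterS (cv_baire_prefix N vb) => n vbn.
rewrite /= /probe; case: pselect => [e|//].
case: ex_minnP => m vm _; apply: HN; rewrite /= leqNgt; apply/negP => mN.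
by apply: nb; exists m; rewrite -vbn.
Qed.

Definition has_baire (K : qcb0 -> Prop) : Prop :=
  exists2 B, K B & iso (seq_lim B) baire.

Lemma qcb0_probe (B Z : qcb0) (i : B -> baire) (u : nat -> Z) x :
  @limcont (seq_lim B) baire i -> u @ \oo --> x -> continuous (probe u x \o i).
Proof.
move=> ci ux; apply/continuous_limcont.
exact: (@limcont_comp (seq_lim B) baire (seq_lim Z)) ci (limcont_probe ux).
Qed.

Lemma continuous_const (X Y : topologicalType) (y : Y) : continuous (fun _ : X => y).
Proof. by move=> x; exact: cvg_cst. Qed.

Definition pairing (X Y P : limspace) (p1 : P -> X) (p2 : P -> Y)
    (pr : X -> Y -> P) : Prop :=
  [/\ forall x y, p1 (pr x y) = x, forall x y, p2 (pr x y) = y,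
      forall p, pr (p1 p) (p2 p) = p &
      forall u x v y, cv u x -> cv v y -> cv (fun n => pr (u n) (v n)) (pr x y)].

(** Constant maps out of the Baire object identify the points of [P] with pairs; the map into [P]
    induced by two probes carries the convergent spikes to the paired sequences. *)
Lemma binary_product_pairing K (X Y P : qcb0) (p1 : P -> X) (p2 : P -> Y) :
  has_baire K -> is_binary_product K p1 p2 ->
  exists pr, @pairing (seq_lim X) (seq_lim Y) (seq_lim P) p1 p2 pr.
Proof.
move=> [B KB [i [j [iK jK ci cj]]]] [KP cp1 cp2 univ].
have pinj p p' : p1 p = p1 p' -> p2 p = p2 p' -> p = p'.
  move=> e1 e2; have [h [_ huniq]] := univ B KB (fun=> p1 p) (fun=> p2 p)
    (@continuous_const _ _ _) (@continuous_const _ _ _).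
  have h1 := huniq (fun=> p) (And3 (@continuous_const _ _ _) erefl erefl).
  have h2 : h = fun=> p'.
    by apply: huniq; split; [exact: continuous_const|rewrite e1|rewrite e2].
  by have := congr1 (@^~ (j flat)) (etrans (esym h1) h2).
have /choice[pr prP] : forall xy : X * Y, exists p, p1 p = xy.1 /\ p2 p = xy.2.
  move=> [x y]; have [h [[_ h1 h2] _]] := univ B KB (fun=> x) (fun=> y)
    (@continuous_const _ _ _) (@continuous_const _ _ _).
  exists (h (j flat)); split.
    by have := congr1 (@^~ (j flat)) h1.
  by have := congr1 (@^~ (j flat)) h2.
exists (fun x y => pr (x, y)); split.
- by move=> x y; have [] := prP (x, y).
- by move=> x y; have [] := prP (x, y).
- by move=> p; apply: pinj; have [] := prP (p1 p, p2 p).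
- move=> u x v y ux vy.
  have [h [[ch h1 h2] _]] := univ B KB _ _ (qcb0_probe ci ux) (qcb0_probe ci vy).
  have hE b : h b = pr (probe u x (i b), probe v y (i b)).
    have [e1 e2] := prP (probe u x (i b), probe v y (i b)).
    by apply: pinj; [rewrite e1 -[LHS]/((p1 \o h) b) h1|
      rewrite e2 -[LHS]/((p2 \o h) b) h2].
  have /continuous_limcont/(_ _ _ (cj _ _ cv_spike)) := ch.
  rewrite /= hE jK !probe_flat; congr (@cv (seq_lim P) _ _).
  by apply: funext => n /=; rewrite hE jK !probe_spike.
Qed.

Lemma pairing_binary_product (K : qcb0 -> Prop) (X Y P : qcb0)
    (p1 : P -> X) (p2 : P -> Y) pr : K P -> continuous p1 -> continuous p2 ->
  @pairing (seq_lim X) (seq_lim Y) (seq_lim P) p1 p2 pr ->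
  is_binary_product K p1 p2.
Proof.
move=> KP cp1 cp2 [pr1 pr2 prK cpr]; split=> // Z KZ f g cf cg.
exists (fun z => pr (f z) (g z)); split.
  split; [|by apply: funext => z /=; rewrite pr1|by apply: funext => z /=; rewrite pr2].
  apply/continuous_limcont => u z uz; apply: cpr.
    exact: (proj1 (continuous_limcont _) cf).
  exact: (proj1 (continuous_limcont _) cg).
by move=> h [_ <- <-]; apply: funext => z /=; rewrite prK.
Qed.

Lemma iso_binary_product (K : qcb0 -> Prop) (X Y P : qcb0) : K P ->
  iso (seq_lim P) (pair_lim (seq_lim X) (seq_lim Y)) ->
  exists (p1 : P -> X) (p2 : P -> Y), is_binary_product K p1 p2.
Proof.
move=> KP [f [g [fK gK cf cg]]].
exists (fun p => (f p).1), (fun p => (f p).2).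
apply: (@pairing_binary_product _ _ _ _ _ _ (fun x y => g (x, y))) => //.
- by apply/continuous_limcont => u p /cf[].
- by apply/continuous_limcont => u p /cf[].
- split=> [x y|x y|p|u x v y ux vy]; rewrite ?gK //.
    by rewrite -surjective_pairing fK.
  by apply: (cg (fun n => (u n, v n)) (x, y)).
Qed.

Lemma realizable_binary_product (X Y : qcb0) :
  realizable (seq_lim X) -> realizable (seq_lim Y) ->
  exists (P : qcb0) (p1 : P -> X) (p2 : P -> Y), is_binary_product QCB0 p1 p2.
Proof.
move=> rX rY; have [P isoP] := realizable_qcb0 (realizable_pair rX rY).
by exists P; exact: iso_binary_product.
Qed.

(** The same test by constant maps and probes, for a family of factors. *)
Lemma product_iso K I (X : I -> qcb0) (P : qcb0) (pr : forall i, P -> X i) :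
  has_baire K -> is_product K pr ->
  iso (seq_lim P) (prod_lim (fun i => seq_lim (X i))).
Proof.
move=> [B KB [i [j [iK jK ci cj]]]] [KP cpr univ].
have pinj p p' : (forall k, pr k p = pr k p') -> p = p'.
  move=> e; have [h [_ huniq]] := univ B KB (fun k _ => pr k p)
    (fun k => @continuous_const _ _ _).
  have h1 := huniq (fun=> p) (conj (@continuous_const _ _ _) (fun=> erefl)).
  have h2 : h = fun=> p'.
    apply: huniq; split; first exact: continuous_const.
    by move=> k; apply: funext => z /=; rewrite e.
  by have := congr1 (@^~ (j flat)) (etrans (esym h1) h2).
apply: (@iso_bij (seq_lim P) (prod_lim (fun k => seq_lim (X k))) (fun p k => pr k p)).
- by move=> p p' e; apply: pinj => k; exact: (congr1 (fun g => g k) e).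
- move=> x; have [h [[_ hx] _]] := univ B KB (fun k _ => x k)
    (fun k => @continuous_const _ _ _).
  exists (h (j flat)); apply: functional_extensionality_dep => k.
  exact: (congr1 (@^~ (j flat)) (hx k)).
- move=> u p; split=> [up k|up].
    exact: (proj1 (continuous_limcont _) (cpr k)).
  have [h [[ch hx] _]] := univ B KB (fun k => probe (pr k \o u) (pr k p) \o i)
    (fun k => qcb0_probe ci (up k)).
  have := proj1 (continuous_limcont _) ch _ _ (cj _ _ cv_spike).
  have -> : h (j flat) = p.
    apply: pinj => k; have := congr1 (@^~ (j flat)) (hx k).
    by rewrite /= jK probe_flat.
  congr (@cv (seq_lim P) _ _); apply: funext => n; apply: pinj => k.
  by have := congr1 (@^~ (j (spike n))) (hx k); rewrite /= jK probe_spike.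
Qed.

Lemma iso_product (K : qcb0 -> Prop) I (X : I -> qcb0) (P : qcb0) : K P ->
  iso (seq_lim P) (prod_lim (fun i => seq_lim (X i))) ->
  exists pr : forall i, P -> X i, is_product K pr.
Proof.
move=> KP [f [g [fK gK cf cg]]]; exists (fun k p => f p k); split=> //.
  by move=> k; apply/continuous_limcont => u p /cf; exact.
move=> Z KZ h ch; exists (fun z => g (fun k => h k z)); split.
  split; last by move=> k; apply: funext => z /=; rewrite gK.
  apply/continuous_limcont => u z uz; apply: (cg (fun n k => h k (u n))) => k.
  exact: (proj1 (continuous_limcont _) (ch k)).
move=> h' [_ hE]; apply: funext => z; rewrite -[RHS]fK; congr g.
by apply: functional_extensionality_dep => k; rewrite -hE.
Qed.

(** The pairings on [P] and [Q] reduce the universal property to currying, and continuous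
    convergence is exactly what makes evaluation and the curried map continuous. *)
Lemma iso_exponential (K : qcb0 -> Prop) (X Y E : qcb0) : has_baire K -> K E ->
  iso (seq_lim E) (map_lim (seq_lim X) (seq_lim Y)) ->
  (exists (P : qcb0) (p1 : P -> E) (p2 : P -> X), is_binary_product K p1 p2) ->
  is_exponential K X Y E.
Proof.
move=> KB KE [f [g [fK gK cf cg]]] [P [p1 [p2 Pprod]]]; split=> //.
have [pr [pr1 pr2 prK cpr]] := binary_product_pairing KB Pprod.
have [_ cp1 cp2 _] := Pprod.
exists P, p1, p2, (fun p => proj1_sig (f (p1 p)) (p2 p)); split=> //.
  apply/continuous_limcont => u p up; apply: (cf (p1 \o u)).
    exact: (proj1 (continuous_limcont _) cp1).
  exact: (proj1 (continuous_limcont _) cp2).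
move=> Z Q q1 q2 KZ Qprod k ck.
have [qr [qr1 qr2 qrK cqr]] := binary_product_pairing KB Qprod.
have [_ cq1 cq2 _] := Qprod.
move/continuous_limcont: (ck) => lk.
have ck1 z : @limcont (seq_lim X) (seq_lim Y) (fun x => k (qr z x)).
  by move=> u x ux; apply: lk; apply: cqr => //; exact: cv_const.
have cgk : @limcont (seq_lim Z) (seq_lim E) (fun z => g (exist _ _ (ck1 z))).
  move=> u z uz; apply: (cg (fun n => exist _ _ (ck1 (u n)))) => v x vx.
  by apply: lk; exact: cqr.
exists (fun z => g (exist _ _ (ck1 z))); split.
  split; first exact/continuous_limcont.
  exists (fun q => pr (g (exist _ _ (ck1 (q1 q)))) (q2 q)); split.
  - apply/continuous_limcont => u q uq; apply: cpr.
      by apply: (cgk (q1 \o u)); exact: (proj1 (continuous_limcont _) cq1).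
    exact: (proj1 (continuous_limcont _) cq2).
  - by apply: funext => q /=; rewrite pr1.
  - by apply: funext => q /=; rewrite pr2.
  - by apply: funext => q /=; rewrite pr1 pr2 gK /= qrK.
move=> g' [cg' [h [ch h1 h2 hk]]]; apply: funext => z.
rewrite -[RHS]fK; congr g; apply: map_lim_inj => x /=.
rewrite -hk /= -[p1 _]/((p1 \o h) (qr z x)) -[p2 _]/((p2 \o h) (qr z x)) h1 h2 /=.
by rewrite qr1 qr2.
Qed.

(** The isomorphism [phi] curries [ev]. Uniqueness of transposes makes it injective, transposing
    constant families makes it surjective, and transposing a probe along a convergent sequence of
    maps shows that it reflects convergence. *)
Lemma exponential_iso (K : qcb0 -> Prop) (X Y E B Q : qcb0)
    (q1 : Q -> B) (q2 : Q -> X) : K B -> iso (seq_lim B) baire ->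
  is_binary_product K q1 q2 -> realizable (map_lim (seq_lim X) (seq_lim Y)) ->
  is_exponential K X Y E -> iso (seq_lim E) (map_lim (seq_lim X) (seq_lim Y)).
Proof.
move=> KB isoB Qprod rXY [KE [P [p1 [p2 [ev [Pprod cev univ]]]]]].
have baireK : has_baire K by exists B.
have [pr [pr1 pr2 prK cpr]] := binary_product_pairing baireK Pprod.
have [i [j [iK jK ci cj]]] := isoB.
have [qr [qr1 qr2 qrK cqr]] := binary_product_pairing baireK Qprod.
have [_ cq1 cq2 _] := Qprod.
move/continuous_limcont: (cev) => lev; move/continuous_limcont: (cq1) => lq1.
move/continuous_limcont: (cq2) => lq2.
have cphi e : @limcont (seq_lim X) (seq_lim Y) (fun x => ev (pr e x)).
  by move=> u x ux; apply: lev; apply: cpr => //; exact: cv_const.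
pose phi e : map_lim (seq_lim X) (seq_lim Y) := exist _ _ (cphi e).
have transpose (F : baire -> map_lim (seq_lim X) (seq_lim Y)) : limcont F ->
    exists2 g : B -> E, continuous g & forall b, phi (g b) = F (i b).
  move=> cF; have [|g [[cg [h [ch h1 h2 hk]]] _]] := univ B Q q1 q2 KB Qprod
      (fun q => proj1_sig (F (i (q1 q))) (q2 q)).
    apply/continuous_limcont => u q uq.
    exact: (cF _ _ (ci _ _ (lq1 _ _ uq)) _ _ (lq2 _ _ uq)).
  exists g => // b; apply: map_lim_inj => x /=.
  have := congr1 (@^~ (qr b x)) hk; rewrite /= qr1 qr2 => <-; congr ev.
  rewrite -[h _]prK -[p1 _]/((p1 \o h) (qr b x)) -[p2 _]/((p2 \o h) (qr b x)).
  by rewrite h1 h2 /= qr1 qr2.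
have phi_inj : injective phi.
  move=> e e' ee'; have [|g [_ guniq]] := univ B Q q1 q2 KB Qprod
      (fun q => ev (pr e (q2 q))).
    by apply/continuous_limcont => u q uq; apply: (cphi e); exact: lq2.
  have const e0 : phi e0 = phi e -> g = fun=> e0.
    move=> e0e; apply: guniq; split; first exact: continuous_const.
    exists (fun q => pr e0 (q2 q)); split.
    - apply/continuous_limcont => u q uq; apply: cpr; first exact: cv_const.
      exact: lq2.
    - by apply: funext => q /=; rewrite pr1.
    - by apply: funext => q /=; rewrite pr2.
    - apply: funext => q /=.
      by have := congr1 (fun h => proj1_sig h (q2 q)) e0e.
  have := etrans (esym (const e erefl)) (const e' (esym ee')).
  exact: (congr1 (@^~ (j flat))).
apply: (@iso_bij (seq_lim E) _ phi) => //.
  move=> h; have [|g _ gE] := transpose (fun=> h); first exact: limcont_cst.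
  by exists (g (j flat)).
move=> u e; split=> [ue v x vx|ue]; first by apply: lev; exact: cpr.
(* Probes take values in a topological space, so the function space is replaced by an isomorphic
   qcb0-space [W]. *)
have [W [wi [wj [wiK wjK cwi cwj]]]] := realizable_qcb0 rXY.
have [|g cg gE] := transpose (wi \o probe (wj \o (phi \o u)) (wj (phi e))).
  by apply: limcont_comp cwi; apply: limcont_probe; exact: (cwj _ _ ue).
have := proj1 (continuous_limcont _) cg _ _ (cj _ _ cv_spike).
have -> : g (j flat) = e.
  by apply: phi_inj; rewrite gE /= jK probe_flat wjK.
congr (@cv (seq_lim E) _ _); apply: funext => n; apply: phi_inj.
by rewrite /= gE /= jK probe_spike /= wjK.
Qed.

(** * Countable ordinals *)

Definition omega1_le (a b : omega1) : Prop := omega1_lt a b \/ a = b.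

Lemma omega1_ltxx a : ~ omega1_lt a a.
Proof. by move=> aa; exact: (powerset_lt_asym aa aa). Qed.

Lemma omega1_leNgt a b : omega1_le a b <-> ~ omega1_lt b a.
Proof.
split=> [[ab|->]|nba]; last 1 first.
- by have [ab|->|//] := omega1_lt_total a b; [left|right].
- by move=> /(omega1_lt_trans ab)/omega1_ltxx.
- exact: omega1_ltxx.
Qed.

Lemma omega1_lt_le_trans a b c : omega1_lt a b -> omega1_le b c -> omega1_lt a c.
Proof. by move=> ab [bc|<-//]; exact: omega1_lt_trans bc. Qed.

Lemma omega1_least (P : set omega1) : P !=set0 ->
  exists2 a, P a & forall b, P b -> omega1_le a b.
Proof.
move=> [a Pa]; apply: contrapT => nex.
elim/(well_founded_ind omega1_lt_wf): a Pa => a IH Pa; apply: nex.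
by exists a => // b Pb; apply/omega1_leNgt => ba; exact: IH Pb.
Qed.

Lemma omega1_zero_ex : exists z, omega1_zero z.
Proof.
have [|z _ zmin] := @omega1_least setT.
  apply/set0P/negP => /eqP T0; apply: omega1_uncountable; rewrite T0.
  exact: countable0.
by exists z => b; apply/omega1_leNgt; exact: zmin.
Qed.

(** An unbounded countable family would cover [omega1] by countably many countable segments. *)
Lemma omega1_lub (I : Type) (a : I -> omega1) : countable [set: I] ->
  exists2 c, forall i, omega1_le (a i) c &
    forall b, (forall i, omega1_le (a i) b) -> omega1_le c b.
Proof.
move=> cI; apply: omega1_least; apply: contrapT => nub; apply: omega1_uncountable.
apply: (sub_countable (B := \bigcup_(i in [set: I]) [set c | omega1_lt c (a i)])).
  apply: subset_card_le => c _; apply: contrapT => nc; apply: nub; exists c => i.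
  by apply/omega1_leNgt => ci; apply: nc; exists i.
by apply: bigcup_countable => // i _; exact: omega1_segment_countable.
Qed.

(** If nothing lay above [a], then [omega1] would be a countable segment together with [a]. *)
Lemma omega1_succ_ex a : exists b, omega1_succ a b.
Proof.
have [|b ab bmin] := @omega1_least [set b | omega1_lt a b].
  apply: contrapT => na; apply: omega1_uncountable.
  pose S (i : bool) := if i then [set b | omega1_lt b a] else [set a].
  apply: (sub_countable (B := \bigcup_(i in [set: bool]) S i)).
    apply: subset_card_le => b _.
    have [ba|->|ab] := omega1_lt_total b a; first by exists true.
      by exists false.
    by case: na; exists b.
  apply: bigcup_countable => [|[] _]; first exact: countableP.
    exact: omega1_segment_countable.
  exact/finite_set_countable/finite_set1.
by exists b; split=> // c cb /bmin/omega1_leNgt.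
Qed.

Lemma omega1_zero_le z a : omega1_zero z -> omega1_le z a.
Proof. by move=> z0; apply/omega1_leNgt; exact: z0. Qed.

Lemma omega1_le_succ a b c : omega1_succ b c -> omega1_lt a c -> omega1_le a b.
Proof. by move=> [_ bc] ac; apply/omega1_leNgt; exact: bc. Qed.

Lemma countable_segment c : countable [set: {b | omega1_lt b c}].
Proof.
have /countable_injP[f finj] := omega1_segment_countable c.
apply/countable_injP; exists (f \o @proj1_sig _ _).
move=> [a ac] [b bc] _ _ /= ab; apply: eq_exist; apply: finj => //; exact: mem_set.
Qed.

Lemma countable_prod (I J : Type) : countable [set: I] -> countable [set: J] ->
  countable [set: I * J].
Proof.
move=> cI cJ; rewrite (_ : setT = setT `*` setT); first exact: countableX.
by apply/seteqP; split.
Qed.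

(** * The spaces of functionals as limit spaces *)

Lemma iso_omega : iso (seq_lim omega) nat_lim.
Proof.
exists id, id; split=> // u x ux; last by apply: cvg_near_cst.
move/cvg_openP: ux => /(_ [set x]); apply=> //; exact: discrete_open.
Qed.

Lemma iso_one : iso (seq_lim one) unit_lim.
Proof.
exists id, id; split=> // u x _; apply: cvg_near_cst.
by exists 0 => // n _ /=; case: (u n) x => -[].
Qed.

Lemma realizable_baire : realizable baire.
Proof.
by apply: realizable_prod => [|_]; [exact: countableP|exact: realizable_nat].
Qed.

Lemma has_baire_QCB0 : has_baire QCB0.
Proof. by have [B isoB] := realizable_qcb0 realizable_baire; exists B. Qed.

Lemma choose_spaceP (S : qcb0 -> Prop) : (exists X, S X) -> S (choose_space S).
Proof.
by rewrite /choose_space; case: pselect => // exS _; exact: (proj2_sig (cid exS)).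
Qed.

(** The qcb0-space realizing the function space is an exponential, so [choose_space] returns a
    genuine one, which [exponential_iso] then identifies. *)
Lemma exponential_omega_iso (X : qcb0) : realizable (seq_lim X) ->
  iso (seq_lim (exponential omega X)) (map_lim (seq_lim X) nat_lim).
Proof.
move=> rX.
have isoM : iso (map_lim (seq_lim X) (seq_lim omega)) (map_lim (seq_lim X) nat_lim).
  exact: iso_map (iso_refl _) iso_omega.
have rM := realizable_iso (iso_sym isoM) (realizable_map rX).
apply: iso_trans isoM.
have [B isoB] := realizable_qcb0 realizable_baire.
have [Q [q1 [q2 Qprod]]] := realizable_binary_product
  (realizable_iso (iso_sym isoB) realizable_baire) rX.
apply: (exponential_iso (K := QCB0) I isoB Qprod rM); apply: choose_spaceP.
have [E isoE] := realizable_qcb0 rM; exists E.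
apply: iso_exponential (isoE) _; [exact: has_baire_QCB0|by []|].
exact: realizable_binary_product (realizable_iso (iso_sym isoE) rM) rX.
Qed.

Lemma product_realizable_iso (I : Type) (X : I -> qcb0) : countable [set: I] ->
  (forall i, realizable (seq_lim (X i))) ->
  iso (seq_lim (product X)) (prod_lim (fun i => seq_lim (X i))).
Proof.
move=> cI rX.
have [pr prP] : exists pr : forall i, product X -> X i, is_product QCB0 pr.
  pose S (P : qcb0) := exists pr : forall i, P -> X i, is_product QCB0 pr.
  apply: (@choose_spaceP S).
  have [P isoP] := realizable_qcb0 (realizable_prod cI rX).
  by exists P; exact: iso_product.
exact: product_iso has_baire_QCB0 prP.
Qed.

Definition functionals_lim (a : omega1) : limspace := seq_lim (functionals a).

Local Notation N := functionals_lim.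

Lemma omega1_cases a : [\/ omega1_zero a, exists b, omega1_succ b a |
  ~ omega1_zero a /\ ~ exists b, omega1_succ b a].
Proof.
have [a0|a0] := pselect (omega1_zero a); first by constructor 1.
have [as_|as_] := pselect (exists b, omega1_succ b a); first by constructor 2.
by constructor 3.
Qed.

(** At each stage the chosen exponential or product is identified from realizable arguments, so
    realizability has to be carried along the recursion. *)
Lemma functionals_realizable a : realizable (N a).
Proof.
elim/(well_founded_ind omega1_lt_wf): a => a IH; rewrite /N.
have [a0|[b ba]|[a0 alim]] := omega1_cases a.
- by rewrite functionals_zero //; apply: realizable_iso (iso_sym iso_omega) realizable_nat.
- rewrite (functionals_succ ba); have rb := IH b (proj1 ba).
  exact: realizable_iso (iso_sym (exponential_omega_iso rb)) (realizable_map rb).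
- rewrite functionals_limit //.
  have rb (b : {b | omega1_lt b a}) : realizable (seq_lim (functionals (proj1_sig b))).
    exact: IH (proj2_sig b).
  apply: realizable_iso (iso_sym (product_realizable_iso (countable_segment a) rb)) _.
  exact: realizable_prod (countable_segment a) rb.
Qed.

Lemma functionals_zero_iso a : omega1_zero a -> iso (N a) nat_lim.
Proof. by move=> a0; rewrite /N functionals_zero //; exact: iso_omega. Qed.

Lemma functionals_succ_iso a b : omega1_succ a b ->
  iso (N b) (map_lim (N a) nat_lim).
Proof.
move=> ab; rewrite /N (functionals_succ ab).
exact/exponential_omega_iso/functionals_realizable.
Qed.

Lemma functionals_limit_iso a : ~ omega1_zero a -> ~ (exists b, omega1_succ b a) ->
  iso (N a) (prod_lim (fun b : {b | omega1_lt b a} => N (proj1_sig b))).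
Proof.
move=> a0 alim; rewrite {1}/N functionals_limit //.
apply: product_realizable_iso => [|b]; first exact: countable_segment.
exact: functionals_realizable.
Qed.

(** Supplies the base point that [factor_map] requires. *)
Lemma functionals_point a : inhabited (N a).
Proof.
elim/(well_founded_ind omega1_lt_wf): a => a IH.
have [a0|[b ba]|[a0 alim]] := omega1_cases a.
- exact: iso_point (iso_sym (functionals_zero_iso a0)) (inhabits (0 : nat_lim)).
- apply: (iso_point (iso_sym (functionals_succ_iso ba))); constructor.
  by exists (fun=> 0); exact: (@limcont_cst _ nat_lim).
- apply: (iso_point (iso_sym (functionals_limit_iso a0 alim))); constructor => -[b ba].
  have Nb : exists _ : N b, True by have [x] := IH b ba; exists x.
  exact: proj1_sig (cid Nb).
Qed.

Lemma iso_pair_unit X : iso (pair_lim X unit_lim) X.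
Proof.
by exists fst, (fun x => (x, tt)); split=> // [[x []]|u x []].
Qed.

Lemma iso_prod_unit I (X : I -> limspace) : (forall i, iso (X i) unit_lim) ->
  iso (prod_lim X) unit_lim.
Proof.
move=> Xu; apply: (iso_trans (iso_prod Xu)); exists (fun=> tt), (fun _ _ => tt).
by split=> // [x|[]//]; apply: funext => i; case: (x i).
Qed.

Lemma iso_prod1 X : iso (prod_lim (fun _ : unit => X)) X.
Proof.
exists (fun x => x tt), (fun x _ => x); split=> // [x|u x ux|u x ux []//].
  by apply: funext => -[].
exact: ux.
Qed.

Lemma factor_unit X : factor unit_lim X.
Proof.
by exists X; apply: (iso_trans (iso_sym (iso_pair_unit X))); exact: iso_pairC.
Qed.

Lemma iso_discrete (V : limspace) : countable [set: V] -> infinite_set [set: V] ->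
  (forall u (x : V), cv u x -> \forall n \near \oo, u n = x) ->
  (forall u (x : V), (\forall n \near \oo, u n = x) -> cv u x) -> iso V nat_lim.
Proof.
move=> cV iV cvE Ecv; have [f [g [fK gK]]] := countable_bij_nat cV iV.
exists f, g; split=> // u x ux; last by apply: Ecv; apply: filterS ux => n /= ->.
by apply: filterS (cvE _ _ ux) => n /= ->.
Qed.

Lemma iso_pair_nat : iso (pair_lim nat_lim nat_lim) nat_lim.
Proof.
apply: iso_discrete => [||u [x y] [/= ux uy]|u [x y] uxy].
- exact: countableP.
- exact: (infinite_prod_nat 0).
- by apply: filterS2 ux uy => n; case: (u n) => a b /= -> ->.
- by split; apply: filterS uxy => n /= ->.
Qed.

Lemma iso_map_nat_nat : iso (map_lim nat_lim nat_lim) (prod_lim (fun _ : nat => nat_lim)).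
Proof.
apply: (iso_trans (iso_map (iso_sym (iso_pair_unit nat_lim)) (iso_refl _))).
apply: (iso_trans (iso_map_nat _)); apply: iso_prod => _; exact: iso_unit_map.
Qed.

(** Over finitely many coordinates pointwise eventual equality is uniform, so the product is
    discrete; a point is determined by its finite list of values, so it is countable. *)
Lemma iso_prod_finite_nat I : finite_set [set: I] -> inhabited I ->
  iso (prod_lim (fun _ : I => nat_lim)) nat_lim.
Proof.
move=> finI [i0]; have /countable_injP[c cinj] := finite_set_countable finI.
have {}cinj : injective c by move=> i j; apply: cinj; rewrite inE.
have /finite_seqP[s cs] := finite_image c finI.
have c_in i : c i \in s.
  have : (c @` setT) (c i) by exists i.
  by rewrite cs.
pose val (x : I -> nat) k := if pselect (exists i, c i = k) is left e
  then x (proj1_sig (cid e)) else 0.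
have valE x i : val x (c i) = x i.
  rewrite /val; case: pselect => [e|[]]; last by exists i.
  by congr x; apply: cinj; exact: (proj2_sig (cid e)).
apply: iso_discrete => [||u x ux|u x ux i].
- apply/countable_injP; exists (fun x => pickle (map (val x) s)) => x y _ _.
  move=> /(pcan_inj pickleK)/eq_in_map xy; apply: funext => i.
  by rewrite -(valE x) -(valE y); exact: xy.
- move=> /(finite_image (fun x : I -> nat => x i0)) fin; apply: infinite_nat.
  rewrite (_ : setT = (fun x : I -> nat => x i0) @` setT) //.
  by apply/seteqP; split=> // n _; exists (fun=> n).
- have := @near_all_in s (fun k n => forall i, c i = k -> u n i = x i).
  case=> [k _|M _ HM]; last first.
    by exists M => // n nM; apply: funext => i; apply: (HM n nM (c i)).
  have [[i ik]|nk] := pselect (exists i, c i = k); last first.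
    by exists 0 => // n _ i ik; case: nk; exists i.
  by apply: filterS (ux i) => n uni j; rewrite -ik => /cinj->.
- by apply: filterS ux => n ->.
Qed.

Lemma factor_iso_l B B' A : iso B B' -> factor B A -> factor B' A.
Proof. by move=> /iso_factor/factor_trans; apply. Qed.

Lemma factor_iso_r B A A' : iso A A' -> factor B A -> factor B A'.
Proof. by move=> /iso_sym/iso_factor AA' BA; exact: factor_trans BA AA'. Qed.

Lemma factor_prod_of_stable J (B : J -> limspace) A : stable A ->
  countable [set: J] -> (forall j, factor (B j) A) -> factor (prod_lim B) A.
Proof.
move=> sA cJ BA; exists A; apply: iso_trans (iso_pairC _ _).
by apply: iso_sym; exact: factor_prod_stable.
Qed.

(** The two claims are proved together because each uses the other at smaller ordinals. *)
Lemma functionals_stable_factor b :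
  (~ omega1_zero b -> stable (N b)) /\ forall a, omega1_le a b -> factor (N a) (N b).
Proof.
elim/(well_founded_ind omega1_lt_wf): b => b IH.
have [b0|[d db]|[b0 blim]] := omega1_cases b.
- by split=> // a [/b0//|->]; exact: factor_refl.
- have [IHs IHf] := IH d (proj1 db).
  (* For [d] zero this is the pairing bijection; otherwise the stable [N d] absorbs its factor
     [nat_lim]. *)
  have natd : iso (pair_lim nat_lim (N d)) (N d).
    have [d0|d0] := pselect (omega1_zero d).
      have dn := functionals_zero_iso d0.
      apply: (iso_trans (iso_pair (iso_refl _) dn)).
      exact: iso_trans iso_pair_nat (iso_sym dn).
    have [z z0] := omega1_zero_ex.
    apply: (iso_trans (iso_pairC _ _)); apply: stable_absorb; first exact: IHs.
    exact: factor_iso_l (functionals_zero_iso z0) (IHf z (omega1_zero_le d z0)).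
  have bd := functionals_succ_iso db.
  (* N<b> = nat^N<d> = nat^(nat * N<d>) = (nat^N<d>)^nat. *)
  have sb : stable (N b).
    apply: stable_iso (iso_sym bd) _; apply: (iso_trans (iso_sym (iso_map_nat _))).
    exact: iso_map natd (iso_refl _).
  (* An inner induction on [a] handles limits: N<a> is then a countable product of factors of the
     stable N<b>. *)
  split=> // a; elim/(well_founded_ind omega1_lt_wf): a => a IHa.
  move=> [ab|->]; last exact: factor_refl.
  have [a0|[c ca]|[a0 alim]] := omega1_cases a.
  (* Here nat = nat^1, and the point is a factor of N<d>. *)
  + apply: factor_iso_l (iso_sym (functionals_zero_iso a0)) _.
    apply: factor_iso_r (iso_sym bd) _; apply: factor_iso_l (iso_unit_map _) _.
    exact: factor_map (factor_unit _) (functionals_point d).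
  + apply: factor_iso_l (iso_sym (functionals_succ_iso ca)) _.
    apply: factor_iso_r (iso_sym bd) _; apply: factor_map (functionals_point d).
    apply: IHf; left.
    exact: omega1_lt_le_trans (proj1 ca) (omega1_le_succ db ab).
  + apply: factor_iso_l (iso_sym (functionals_limit_iso a0 alim)) _.
    apply: factor_prod_of_stable => [//||[c ca] /=]; first exact: countable_segment.
    by apply: IHa => //; left; exact: omega1_lt_trans ab.
- have blimP := functionals_limit_iso b0 blim; split=> [_|a [ab|->]]; last 1 first.
  + exact: factor_refl.
  + pose S := {c | omega1_lt c b}.
    (* The successor coordinate is nonzero, hence stable by induction, and has N<c> as a factor; it
       stays below the limit [b]. *)
    have succ_lt (c : S) : exists c' : S, omega1_succ (proj1_sig c) (proj1_sig c').
      case: c => c cb; have [c' cc'] := omega1_succ_ex c.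
      have [c'b|c'b|bc'] := omega1_lt_total c' b; first by exists (exist _ c' c'b).
        by case: blim; exists c; rewrite -c'b.
      by case: (proj2 cc' b bc').
    have [t tP] := choice succ_lt.
    apply: stable_iso (iso_sym blimP) _.
    pose P := prod_lim (fun c : S => N (proj1_sig c)); rewrite -/P /stable.
    pose M := prod_lim (fun p : nat * S => N (proj1_sig p.2)).
    have PM : iso (prod_lim (fun _ : nat => P)) M by exact: iso_prod_curry.
    (* All copies of N<c> in [M = P^nat] are absorbed by coordinate [c + 1] of [P]; then P^nat = P *
       P^nat = P. *)
    have absorb : iso (pair_lim P M) P.
      apply: (@prod_absorb S _ _ _ (fun p => t p.2)) => [|[n c]|[n c]] /=.
      * by apply: countable_prod (countable_segment b); exact: countableP.
      * have [st _] := IH _ (proj2_sig (t c)); apply: st => /(_ (proj1_sig c)).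
        by apply; exact: (proj1 (tP c)).
      * have [_ ft] := IH _ (proj2_sig (t c)); apply: ft; left.
        exact: (proj1 (tP c)).
    apply: iso_trans absorb; apply: (iso_trans (iso_prod_nat_cons _)).
    exact: iso_pair (iso_refl _) PM.
  + apply: factor_iso_r (iso_sym blimP) _.
    by have := iso_prod_split (fun c : {c | omega1_lt c b} => N (proj1_sig c))
      (exist _ a ab); exists (prod_lim (fun j : {j : {c | omega1_lt c b} |
         j <> exist _ a ab} => N (proj1_sig (proj1_sig j)))).
Qed.

Lemma functionals_stable b : ~ omega1_zero b -> stable (N b).
Proof. by have [] := functionals_stable_factor b. Qed.

Lemma functionals_factor a b : omega1_le a b -> factor (N a) (N b).
Proof. by have [_] := functionals_stable_factor b; apply. Qed.

(** * Closure properties of F *)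

(** [F] consists of specific spaces, so its closure properties are first proved for limit spaces up
    to isomorphism. *)
Definition inF (V : limspace) : Prop := exists2 X, F X & iso (seq_lim X) V.

Lemma inF_iso V W : iso V W -> inF V -> inF W.
Proof. by move=> VW [X FX XV]; exists X => //; exact: iso_trans XV VW. Qed.

Lemma inF_functionals a : inF (N a).
Proof. by exists (functionals a); [right; exists a|exact: iso_refl]. Qed.

Lemma inF_unit : inF unit_lim.
Proof. by exists one; [left|exact: iso_one]. Qed.

Lemma inF_nat : inF nat_lim.
Proof.
have [z z0] := omega1_zero_ex.
exact: inF_iso (functionals_zero_iso z0) (inF_functionals z).
Qed.

Lemma inF_cases V : inF V -> iso V unit_lim \/ exists a, iso V (N a).
Proof.
move=> [X [->|[a ->]] XV]; [left|right; exists a]; last exact: iso_sym.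
by apply: iso_trans (iso_sym XV) _; exact: iso_one.
Qed.

Lemma inF_map_nat V : inF V -> inF (map_lim V nat_lim).
Proof.
move=> /inF_cases[VU|[a Va]].
  apply: inF_iso inF_nat; apply: iso_trans (iso_sym (iso_unit_map _)) _.
  exact: iso_map (iso_sym VU) (iso_refl _).
have [b ab] := omega1_succ_ex a; apply: inF_iso (inF_functionals b).
apply: (iso_trans (functionals_succ_iso ab)).
exact: iso_map (iso_sym Va) (iso_refl _).
Qed.

(** The power is a point, [nat_lim] or Baire space, according as [I] is empty, finite and inhabited,
    or infinite. *)
Lemma inF_prod_nat I : countable [set: I] -> inF (prod_lim (fun _ : I => nat_lim)).
Proof.
move=> cI; have [I0|nI0] := pselect (I -> False).
  exact: inF_iso (iso_sym (iso_prod0 _ I0)) inF_unit.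
have iI : inhabited I by apply: contrapT => nI; apply: nI0 => i; case: nI.
have [finI|infI] := pselect (finite_set [set: I]).
  exact: inF_iso (iso_sym (iso_prod_finite_nat finI iI)) inF_nat.
have [f [g [fK gK]]] := countable_bij_nat cI infI.
apply: inF_iso (inF_map_nat inF_nat).
apply: (iso_trans iso_map_nat_nat).
exact: (iso_prod_reindex (fun=> nat_lim) fK gK).
Qed.

(** Unless all [a i] are zero, let [c] be their supremum: N<c> and the product [P] absorb each
    other, so both are isomorphic to N<c> * P. *)
Lemma inF_prod_functionals I (a : I -> omega1) : countable [set: I] ->
  inF (prod_lim (fun i => N (a i))).
Proof.
move=> cI; set P := prod_lim _.
have [[i0 a0]|a0] := pselect (exists i, ~ omega1_zero (a i)); last first.
  apply: inF_iso (inF_prod_nat cI); apply: iso_prod => i; apply: iso_sym.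
  apply: functionals_zero_iso; apply: contrapT => ai; apply: a0; by exists i.
have [c ac cmin] := omega1_lub a cI.
have c0 : ~ omega1_zero c.
  move=> c0; apply: a0; have [/c0//|->//] := ac i0.
apply: inF_iso (inF_functionals c).
have cP : iso (pair_lim (N c) P) (N c).
  apply: factor_prod_stable => // [|i]; first exact: functionals_stable.
  exact: functionals_factor.
suff Pc : iso (pair_lim P (N c)) P.
  exact: iso_trans (iso_sym cP) (iso_trans (iso_pairC _ _) Pc).
(* If [c] is attained, that coordinate absorbs N<c>. Otherwise [c] is a limit, as a predecessor
   would already bound the family, and each N<d> with [d < c] is absorbed by a coordinate with
   [d < a i]. *)
have [[i ai]|nac] := pselect (exists i, a i = c).
  apply: iso_trans (iso_pair (iso_refl _) (iso_sym (iso_prod1 _))) _.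
  apply: (@prod_absorb I unit _ _ (fun=> i)) => [|_|_]; first exact: countableP.
    by rewrite ai; exact: functionals_stable.
  by rewrite ai; exact: factor_refl.
have {nac}ac i : omega1_lt (a i) c by have [//|aic] := ac i; case: nac; exists i.
have clim : ~ exists d, omega1_succ d c.
  move=> [d dc]; have /cmin/omega1_leNgt : forall i, omega1_le (a i) d.
    by move=> i; exact: omega1_le_succ dc (ac i).
  by apply; exact: (proj1 dc).
have /choice[t tP] : forall d : {d | omega1_lt d c},
    exists i, omega1_lt (proj1_sig d) (a i).
  move=> [d dc] /=; apply: contrapT => nd.
  have /cmin/omega1_leNgt : forall i, omega1_le (a i) d.
    by move=> i; apply/omega1_leNgt => di; apply: nd; exists i.
  exact.
apply: iso_trans (iso_pair (iso_refl _) (functionals_limit_iso c0 clim)) _.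
apply: (@prod_absorb _ _ _ _ t) => [|d|d]; first exact: countable_segment.
  by apply: functionals_stable => /(_ (proj1_sig d)); apply; exact: tP.
by apply: functionals_factor; left; exact: tP.
Qed.

(** Factors that are no N<a> are points. Splitting the index set by the boolean [t] collects them
    into a single point, which drops out. *)
Lemma inF_prod I (X : I -> limspace) : countable [set: I] ->
  (forall i, inF (X i)) -> inF (prod_lim X).
Proof.
move=> cI FX; pose t i : bool := `[< exists a, iso (X i) (N a) >].
apply: inF_iso (iso_sym (iso_prod_fibers t X)) _.
apply: inF_iso (iso_sym (iso_prod_bool _)) _.
have unitP : iso (prod_lim (fun i : {i | t i = false} => X (proj1_sig i))) unit_lim.
  apply: iso_prod_unit => -[i /= /asboolP ti].
  by have [//|/ti] := inF_cases (FX i).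
apply: inF_iso (iso_sym (iso_pair (iso_refl _) unitP)) _.
apply: inF_iso (iso_sym (iso_pair_unit _)) _.
have /choice[a aP] : forall i : {i | t i = true}, exists a, iso (X (proj1_sig i)) (N a).
  by move=> [i /= /asboolP].
apply: inF_iso (inF_prod_functionals a _).
  by apply: iso_prod => i; apply: iso_sym.
have /countable_injP[c cinj] := cI; apply/countable_injP.
exists (c \o @proj1_sig _ _) => -[i ti] [j tj] _ _ /= ij.
by apply: eq_exist; apply: cinj ij; rewrite inE.
Qed.

Lemma inF_pair V W : inF V -> inF W -> inF (pair_lim V W).
Proof.
move=> FV FW; apply: inF_iso (iso_prod_bool (fun b => if b then V else W)) _.
by apply: inF_prod => [|[]]//; exact: countableP.
Qed.

(** At a limit, maps into a product form a product of function spaces, so [inF_prod] applies. *)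
Lemma inF_map V W : inF V -> inF W -> inF (map_lim V W).
Proof.
move=> FV /inF_cases[Wu|[b Wb]].
  apply: inF_iso inF_unit; apply: iso_sym.
  exact: iso_trans (iso_map (iso_refl _) Wu) (iso_map_unit V).
apply: inF_iso (iso_map (iso_refl _) (iso_sym Wb)) _ => {Wb}.
elim/(well_founded_ind omega1_lt_wf): b => b IH.
have [b0|[d db]|[b0 blim]] := omega1_cases b.
- apply: inF_iso (inF_map_nat FV).
  exact: iso_map (iso_refl _) (iso_sym (functionals_zero_iso b0)).
- apply: inF_iso (iso_map (iso_refl _) (iso_sym (functionals_succ_iso db))) _.
  apply: inF_iso (iso_sym (iso_map_curry _ _ _)) _.
  exact: inF_map_nat (inF_pair FV (inF_functionals d)).
- apply: inF_iso (iso_map (iso_refl _) (iso_sym (functionals_limit_iso b0 blim))) _.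
  apply: inF_iso (iso_sym (iso_map_prod _ _)) _.
  by apply: inF_prod => [|[d db]]; [exact: countable_segment|exact: IH].
Qed.

Lemma inF_seq_lim X : F X -> inF (seq_lim X).
Proof. by move=> FX; exists X => //; exact: iso_refl. Qed.

Lemma has_baire_F : has_baire F.
Proof.
have [B FB isoB] : inF baire by apply: inF_prod => [|_]; [exact: countableP|exact: inF_nat].
by exists B.
Qed.

Lemma F_binary_product X Y : F X -> F Y ->
  exists (P : qcb0) (p1 : P -> X) (p2 : P -> Y), is_binary_product F p1 p2.
Proof.
move=> FX FY; have [P FP isoP] := inF_pair (inF_seq_lim FX) (inF_seq_lim FY).
by exists P; exact: iso_binary_product.
Qed.

Lemma F_cartesian_closed : cartesian_closed F.
Proof.
split; last 1 first.
- move=> X Y FX FY; have [E FE isoE] := inF_map (inF_seq_lim FX) (inF_seq_lim FY).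
  exists E; apply: iso_exponential isoE _ => //; first exact: has_baire_F.
  exact: F_binary_product.
- exists one; split=> [|Z _]; first by left.
  exists (fun=> tt); split=> [|h _]; first exact: continuous_const.
  by apply: funext => z; case: (h z).
- exact: F_binary_product.
Qed.

Lemma F_closed_countable_product : closed_countable_product F.
Proof.
move=> I X cI FX; have [P FP isoP] := inF_prod cI (fun i => inF_seq_lim (FX i)).
by have [pr prP] := iso_product (K := QCB0) Logic.I isoP; exists P, pr.
Qed.

(** * Minimality of [F] *)

Lemma closed_prod_iso (C : qcb0 -> Prop) I (X : I -> qcb0) (V : I -> limspace) :
  closed_countable_product C -> countable [set: I] -> (forall i, C (X i)) ->
  (forall i, iso (seq_lim (X i)) (V i)) ->
  exists2 P, C P & iso (seq_lim P) (prod_lim V).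
Proof.
move=> prodC cI CX XV; have [P [pr [CP prP]]] := prodC I X cI CX.
exists P => //; apply: iso_trans (iso_prod XV).
(* The product inherited by [C] is universal in all of [QCB0], so the Baire object of [QCB0] tests
   it. *)
exact: product_iso has_baire_QCB0 prP.
Qed.

(** Exponentials of [C] are universal only within [C]. They can still be identified, because [C]
    contains Baire space as a countable power of [omega]. *)
Lemma closed_functionals (C : qcb0 -> Prop) a : cartesian_closed C ->
  closed_countable_product C -> C omega -> exists2 Y, C Y & iso (seq_lim Y) (N a).
Proof.
move=> cccC prodC Comega; elim/(well_founded_ind omega1_lt_wf): a => a IH.
have [a0|[b ba]|[a0 alim]] := omega1_cases a.
- by exists omega => //; exact: iso_trans iso_omega (iso_sym (functionals_zero_iso a0)).
- have [Y CY isoY] := IH b (proj1 ba); have [_ binC expC] := cccC.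
  have [E EP] := expC Y omega CY Comega; exists E; first by case: EP.
  have [B CB isoB] := closed_prod_iso prodC (countableP _) (fun=> Comega) (fun _ : nat => iso_omega).
  have [Q [q1 [q2 Qprod]]] := binC B Y CB CY.
  have isoM : iso (map_lim (seq_lim Y) (seq_lim omega)) (N a).
    apply: (iso_trans (iso_map isoY iso_omega)).
    exact: iso_sym (functionals_succ_iso ba).
  apply: iso_trans (isoM); apply: (exponential_iso CB isoB Qprod _ EP).
  exact: realizable_iso (iso_sym isoM) (functionals_realizable a).
- have /choice[Y YP] : forall b : {b | omega1_lt b a},
      exists Y, C Y /\ iso (seq_lim Y) (N (proj1_sig b)).
    by move=> [b ba]; have [Y CY isoY] := IH b ba; exists Y.
  have [P CP isoP] := closed_prod_iso prodC (countable_segment a)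
    (fun b => proj1 (YP b)) (fun b => proj2 (YP b)).
  by exists P => //; exact: iso_trans isoP (iso_sym (functionals_limit_iso a0 alim)).
Qed.

(** The point arises as the product of the empty family. *)
Lemma closed_one (C : qcb0 -> Prop) : closed_countable_product C -> C omega ->
  exists2 Y, C Y & iso (seq_lim Y) unit_lim.
Proof.
move=> prodC Comega; have void0 (i : void) : False by case: i.
have [P CP isoP] := closed_prod_iso prodC (countableP setT)
  (fun i : void => False_ind (C omega) (void0 i)) (fun=> iso_omega).
by exists P => //; exact: iso_trans isoP (iso_prod0 _ void0).
Qed.

Theorem theorem7p3 :
  (cartesian_closed F /\ closed_countable_product F) /\
  (forall C : qcb0 -> Prop,
     cartesian_closed C -> closed_countable_product C -> C omega ->
     forall X : qcb0, F X -> exists Y : qcb0, C Y /\ homeomorphic X Y).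
Proof.
split; first by split; [exact: F_cartesian_closed|exact: F_closed_countable_product].
move=> C cccC prodC Comega X [->|[a ->]].
  have [Y CY isoY] := closed_one prodC Comega; exists Y; split=> //.
  by apply/homeomorphicP; exact: iso_trans iso_one (iso_sym isoY).
have [Y CY isoY] := closed_functionals a cccC prodC Comega; exists Y; split=> //.
exact/homeomorphicP/iso_sym.
Qed.
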